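(* Let $0<p\le q<\infty$, $\omega\in\widetilde{\mathcal{I}}$ and $\beta\in(0,1)$. Then there exists a $q$-Carleson measure $\mu$ for $A^p_\omega$ which does not satisfy $$\sup_{a\in\mathbb{D}}\frac{\mu\left(D(a,\beta(1-|a|))\right)}{\left(\omega\left(D(a,\beta(1-|a|))\right)\right)^{q/p}}<\infty .$$
   Context: $\mathbb{D}$ is the open unit disc of $\mathbb{C}$, $dA=\frac{dx\,dy}{\pi}$, and $D(a,r)=\{z:|z-a|<r\}$. A weight is a function $\omega:\mathbb{D}\to(0,\infty)$ integrable over $\mathbb{D}$; it is radial if $\omega(z)=\omega(|z|)$. For a radial weight put $\psi_\omega(r)=\frac{1}{\omega(r)}\int_r^1\omega(s)\,ds$. $\mathcal{I}$ is the class of continuous radial weights with $\lim_{r\to1^-}\frac{\psi_\omega(r)}{1-r}=\infty$. $\widetilde{\mathcal{I}}$ is the class of those $\omega\in\mathcal{I}$ such that for each $s\in[0,1)$ there is a constant $C=C(s,\omega)>1$ with $C^{-1}\omega(t)\le\omega(r)\le C\omega(t)$ whenever $0\le r\le t\le r+s(1-r)<1$. $A^p_\omega$ consists of analytic $f$ in $\mathbb{D}$ with $\|f\|_{A^p_\omega}^p=\int_{\mathbb{D}}|f|^p\omega\,dA<\infty$. A positive Borel measure $\mu$ on $\mathbb{D}$ is a $q$-Carleson measure for $A^p_\omega$ if the identity operator $A^p_\omega\to L^q(\mu)$ is bounded. For measurable $E\subset\mathbb{D}$, $\omega(E)=\int_E\omega\,dA$. *)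

(* Defs.v *)
From HB Require Import structures.
From mathcomp Require Import all_boot all_order all_algebra.
From mathcomp Require Import complex.
From mathcomp Require Import all_classical all_reals all_analysis.
Set Implicit Arguments.
Unset Strict Implicit.
Unset Printing Implicit Defensive.
Import Order.TTheory GRing.Theory Num.Theory.
Import numFieldTopology.Exports numFieldNormedType.Exports.
Import Normc.
Local Open Scope classical_set_scope.
Local Open Scope complex_scope.
Local Open Scope ring_scope.

(* Euclidean discs in the complex plane; the modulus [normc] is real-valued. *)
Definition disc (R : realType) (a : R[i]) (r : R) : set R[i] :=
  [set z | normc (z - a) < r].

Definition unit_disc (R : realType) : set R[i] := disc 0 1.
Arguments unit_disc R : clear implicits.

(* Measures live on R * R, whose product sigma-algebra is the Borel
   sigma-algebra of the plane; [cplx] identifies R * R with R[i]. *)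
Notation R2 R := (measurableTypeR R * measurableTypeR R)%type.

Definition cplx (R : realType) (w : R2 R) : R[i] := w.1 +i* w.2.

Definition plane (R : realType) (E : set R[i]) : set (R2 R) := @cplx R @^-1` E.

Lemma pi_inv_ge0 (R : realType) : 0 <= (pi : R)^-1.
Proof. by rewrite invr_ge0 pi_ge0. Qed.

Definition dA (R : realType) : {measure set (R2 R) -> \bar R} :=
  mscale (NngNum (pi_inv_ge0 R)) (lebesgue_measure \x lebesgue_measure)%E.

(* Only the values of omega on the unit disc matter. *)
Definition weight (R : realType) (omega : R[i] -> R) : Prop :=
  (forall z, unit_disc R z -> 0 < omega z) /\
  (@dA R).-integrable (plane (unit_disc R)) (fun w => (omega (cplx w))%:E).

Definition radial (R : realType) (omega : R[i] -> R) : Prop :=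
  forall z, unit_disc R z -> omega z = omega (normc z)%:C.

Definition psi (R : realType) (omega : R[i] -> R) (r : R) : R :=
  (omega r%:C)^-1 * \int[lebesgue_measure]_(s in `]r, 1[) omega s%:C.

Definition class_I (R : realType) (omega : R[i] -> R) : Prop :=
  [/\ weight omega, radial omega,
      forall z, unit_disc R z -> {for z, continuous (omega : R[i]^o -> R)} &
      psi omega r / (1 - r) @[r --> 1^'-] --> +oo].

Definition class_I_tilde (R : realType) (omega : R[i] -> R) : Prop :=
  class_I omega /\
  forall s : R, 0 <= s < 1 -> exists2 C : R, 1 < C &
    forall r t : R, 0 <= r -> r <= t -> t <= r + s * (1 - r) ->
      r + s * (1 - r) < 1 ->
      C^-1 * omega t%:C <= omega r%:C <= C * omega t%:C.

(* Complex differentiability: the scalar field of [derivable] is R[i]. *)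
Definition analytic_in_disc (R : realType) (f : R[i] -> R[i]) : Prop :=
  forall z, unit_disc R z -> derivable (f : R[i]^o -> R[i]^o) z 1.

Local Open Scope ereal_scope.

Definition bergman_norm (R : realType) (p : R) (omega : R[i] -> R)
    (f : R[i] -> R[i]) : \bar R :=
  (\int[@dA R]_(w in plane (unit_disc R))
     (normc (f (cplx w)) `^ p * omega (cplx w))%:E) `^ p^-1.

Definition bergman_space (R : realType) (p : R) (omega : R[i] -> R) :
    set (R[i] -> R[i]) :=
  [set f | analytic_in_disc f /\ bergman_norm p omega f < +oo].

Definition Lq_norm (R : realType) (q : R)
    (mu : {measure set (R2 R) -> \bar R}) (f : R[i] -> R[i]) : \bar R :=
  (\int[mu]_(w in plane (unit_disc R)) (normc (f (cplx w)) `^ q)%:E) `^ q^-1.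

(* A Borel measure on the unit disc is a Borel measure on the plane that
   vanishes off the disc. *)
Definition measure_on_disc (R : realType)
    (mu : {measure set (R2 R) -> \bar R}) : Prop :=
  mu (~` plane (unit_disc R)) = 0.

Definition carleson_measure (R : realType) (p q : R) (omega : R[i] -> R)
    (mu : {measure set (R2 R) -> \bar R}) : Prop :=
  measure_on_disc mu /\
  exists C : R, forall f, bergman_space p omega f ->
    Lq_norm q mu f <= C%:E * bergman_norm p omega f.

Definition weight_mass (R : realType) (omega : R[i] -> R) (E : set R[i]) :
    \bar R :=
  \int[@dA R]_(w in plane E) (omega (cplx w))%:E.

(* Main.v *)
Require Import Defs.
From HB Require Import structures.
From mathcomp Require Import all_boot all_order all_algebra.
From mathcomp Require Import complex.
From mathcomp Require Import all_classical all_reals all_analysis.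
From mathcomp Require Import measurable_realfun.
From mathcomp Require Import ring lra.
Import Order.TTheory GRing.Theory Num.Theory.
Import numFieldTopology.Exports numFieldNormedType.Exports.
Import Normc.
Set Implicit Arguments.
Unset Strict Implicit.
Unset Printing Implicit Defensive.
Local Open Scope classical_set_scope.
Local Open Scope complex_scope.
Local Open Scope ring_scope.

(** The measure is a series of point masses at points r_k of the real axis that
    tend to the boundary.  Let M_k be the constant of the evaluation
    |f(r_k)|^p <= M_k ||f||^p on A^p_omega, and let W_k bound the
    omega-mass of the disc D(r_k, beta (1 - r_k)).  With the mass
    2^-(k+1) M_k^(-q/p) at r_k, the integral of |f|^q is at most
    sum_k 2^-(k+1) ||f||^q = ||f||^q, so the measure is q-Carleson
    ([carleson_atomic_measure]), while the k-th quotient is at least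
    2^-(k+1) (M_k W_k)^(-q/p) ([atomic_quotients_unbounded]).  So everything
    rests on finding r for which M W is as small as desired
    ([small_disc_evaluation]).

    For r near 1 the weight is comparable to omega(r) on the disc, hence W is of
    the order of omega(r) (1-r)^2 ([disc_mass_le]).  Evaluation at r, on the
    other hand, is controlled by the whole annulus rho < |z| < 1 with
    rho = (1+r)/2: |f(r)|^p times the omega-mass of that annulus is at most
    C/(1-r) ||f||^p ([point_evaluation]).  The annulus has mass at least a
    constant times the integral of omega over (rho, 1), that is
    psi(rho) omega(rho) ([annulus_mass_ge]), and omega(rho) is comparable to
    omega(r).  Hence M W is at most a constant times (1-rho)/psi(rho), which
    tends to 0 by the definition of the class I: the weight is so heavy at the
    boundary that the disc carries a negligible part of the mass that governs
    the value at its centre.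

    The estimate of |f(r)|^p has to hold for every p > 0.  Its source is
    [circle_bound]: |F(b)|^p <= C/(1-|b|) times the mean of |F|^p over the unit
    circle.  When p < 1 the Cauchy formula does not give this, because |F|^p is
    not the modulus of an analytic function.  The proof replaces |F|^p by an
    analytic majorant: a positive combination Phi of Schwarz kernels
    (1+w)/(1-w), with poles slightly outside the disc, such that
    |F|^p <= Re Phi on the circle.  As Phi has no zeros, the maximum modulus
    principle applies to F^n / Phi^m, where m is the integer part of n/p;
    letting n tend to infinity gives |F(b)|^p <= |Phi(b)|
    ([holo_power_majorant]), and |Phi(b)| is estimated term by term.  This
    avoids logarithms and fractional powers of analytic functions.  The maximum
    principle itself is derived from Goursat's theorem on rectangles
    ([contour_eq0]), applied to F(e^w) on [x, 0] x [0, 2 pi]: by periodicity the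
    mean of F over circles about 0 does not depend on the radius.

    The passage from circles to the annulus uses no polar coordinates.  Planar
    Lebesgue measure is invariant under rotations, since a rotation is a product
    of three shears ([ge0_integral_rot]); averaging over all rotations turns the
    integral over the annulus into an integral of circular means. *)

(** * Complex derivability *)

Lemma derivable_complex_comp (K : numFieldType) (f g : K^o -> K^o) (z : K^o) :
  derivable g z 1 -> derivable f (g z) 1 -> derivable (f \o g) z 1.
Proof.
move=> /derivable1_diffP dg /derivable1_diffP df.
by apply/derivable1_diffP; apply: differentiable_comp.
Qed.

Section holo.
Variable R : realType.
Local Notation C := R[i].
Implicit Types (f g : C -> C) (z : C).

Definition holo f z := derivable (f : C^o -> C^o) z 1.

Lemma holo_comp f g z : holo g z -> holo f (g z) -> holo (f \o g) z.
Proof. exact: derivable_complex_comp. Qed.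
Lemma holoD f g z : holo f z -> holo g z -> holo (fun w => f w + g w) z.
Proof. by move=> df dg; exact: (derivableD df dg). Qed.
Lemma holoM f g z : holo f z -> holo g z -> holo (fun w => f w * g w) z.
Proof. by move=> df dg; exact: (derivableM df dg). Qed.
Lemma holoV f z : f z != 0 -> holo f z -> holo (fun w => (f w)^-1) z.
Proof. by move=> f0 df; exact: (derivableV f0 df). Qed.
Lemma holo_cst c z : holo (fun=> c) z.
Proof. exact: derivable_cst. Qed.
Lemma holo_id z : holo id z.
Proof. exact: derivable_id. Qed.
Lemma holoX f n z : holo f z -> holo (fun w => f w ^+ n) z.
Proof. by move=> df; elim: n => [|n ih]; [exact: holo_cst|under eq_fun do rewrite exprS; exact: holoM]. Qed.

Lemma normC_E z : `|z| = (normc z)%:C.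
Proof. by rewrite normc_def; case: z. Qed.

(** The norm of the complex numbers takes complex values; all estimates below
    are real, and use this reformulation with [normc]. *)
Lemma holoP f z : holo f z <-> exists d, forall e : R, 0 < e ->
  exists2 del : R, 0 < del & forall h, normc h < del ->
   normc (f (z + h) - f z - d * h) <= e * normc h.
Proof.
split.
- move=> df.
  have := df.
  rewrite /holo /derivable => /cvg_ex[d] /cvgrPdist_le H.
  exists d => e e0.
  have e0' : 0 < e%:C :> C by rewrite ltcR.
  have := H _ e0' => /nbhs_ballP[del del0 Hd].
  have [d0 dE] : 0 < complex.Re del /\ del = (complex.Re del)%:C.
    by move: del0; case: (del) => a b /=; rewrite ltcE /= => /andP[/eqP -> ].
  exists (complex.Re del) => // h hd.
  have [->|h0] := eqVneq h 0.
    by rewrite addr0 mulr0 subrr subr0 normc0 mulr0.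
  have /= := Hd h.
  rewrite /ball /= /ball_ sub0r normrN normC_E dE ltcR => /(_ hd h0).
  rewrite normC_E lecR -(ler_pM2r (_ : 0 < normc h)) //; last first.
    by rewrite -ltcR -normC_E normr_gt0.
  rewrite -normcM; apply: le_trans; rewrite le_eqVlt; apply/orP; left; apply/eqP.
  rewrite -normcN; congr normc.
  rewrite /GRing.scale /= mulrBl mulrAC mulVf // mul1r mulr1 [h + z]addrC.
  by rewrite opprB.
- move=> [d H]; apply/cvg_ex; exists d; apply/cvgrPdist_le => e e0.
  have [er eE] : 0 < complex.Re e /\ e = (complex.Re e)%:C.
    by move: e0; case: (e) => a b /=; rewrite ltcE /= => /andP[/eqP -> ].
  have [del del0 Hd] := H _ er.
  apply/nbhs_ballP; exists del%:C => /=; first by rewrite ltcR.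
  move=> h; rewrite /ball /= /ball_ sub0r normrN normC_E ltcR => hd h0.
  move: (Hd _ hd) => {}Hd.
  rewrite normC_E eE lecR -(ler_pM2r (_ : 0 < normc h)) //; last first.
    by rewrite -ltcR -normC_E normr_gt0.
  rewrite -normcM; apply: le_trans Hd; rewrite le_eqVlt; apply/orP; left; apply/eqP.
  rewrite -normcN; congr normc.
  rewrite /GRing.scale /= mulrBl mulrAC mulVf // mul1r mulr1 [h + z]addrC.
  by rewrite opprB.
Qed.
End holo.

(** * Integrals of continuous functions over segments *)

Section itv_int.
Variable R : realType.
Local Notation mu := (@lebesgue_measure R).
Implicit Types (f g : R -> R) (a b c : R).

(** Continuity at the end points is two-sided: the functions integrated below
    are continuous in a neighbourhood of the segment. *)
Definition cont_on a b f := forall x, a <= x <= b -> {for x, continuous f}.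

Lemma cont_on_integrable f a b : cont_on a b f ->
  mu.-integrable `[a, b] (EFin \o f).
Proof.
move=> cf; apply: continuous_compact_integrable; first exact: segment_compact.
apply: continuous_in_subspaceT => x; rewrite inE /= in_itv /=; exact: cf.
Qed.

Lemma Rintegral_itv_cst a b c : a <= b ->
  \int[mu]_(x in `[a, b]) c = c * (b - a).
Proof.
move=> ab; rewrite Rintegral_cst //= lebesgue_measure_itv /= lte_fin.
by move: ab; rewrite le_eqVlt => /predU1P[->|->] //=; rewrite ltxx subrr.
Qed.

Lemma Rintegral_split f a b c : a <= c -> c <= b -> cont_on a b f ->
  \int[mu]_(x in `[a, b]) f x =
  \int[mu]_(x in `[a, c]) f x + \int[mu]_(x in `[c, b]) f x.
Proof.
move=> ac cb cf; have fi := cont_on_integrable cf.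
have := @Rintegral_itvB R f (BLeft a) (BRight b) c fi.
rewrite !bnd_simp => /(_ ac cb).
rewrite Rintegral_itv_obnd_cbnd; last first.
  by apply: integrableS fi => //=; apply: subset_itv; rewrite bnd_simp.
by move=> <-; rewrite addrC subrK.
Qed.

Lemma le_Rintegral_itv f g a b : cont_on a b f -> cont_on a b g ->
  (forall x, a <= x <= b -> f x <= g x) ->
  \int[mu]_(x in `[a, b]) f x <= \int[mu]_(x in `[a, b]) g x.
Proof.
move=> cf cg fg; apply: le_Rintegral => //; exact: cont_on_integrable.
Qed.

Lemma cont_on_cst a b c : cont_on a b (fun=> c).
Proof. by move=> x _; exact: cvg_cst. Qed.

(** This is the only estimate of integrals in the proof of Goursat's theorem: for
    two opposite sides of a rectangle, [c] is the increment of the linear part. *)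
Lemma Rintegral_diff_le f g a b c M : a <= b -> cont_on a b f -> cont_on a b g ->
  (forall x, a <= x <= b -> `|f x - g x - c| <= M) ->
  `|\int[mu]_(x in `[a, b]) f x - \int[mu]_(x in `[a, b]) g x - c * (b - a)| <= M * (b - a).
Proof.
move=> ab cf cg fg.
have cfg : cont_on a b (fun x => f x - g x).
  by move=> x axb; apply: continuousB; [exact: cf|exact: cg].
rewrite -RintegralB //; try exact: cont_on_integrable.
have H x : a <= x <= b -> c - M <= f x - g x <= c + M.
  by move=> /fg; rewrite ler_norml; lra.
rewrite ler_distl; apply/andP; split.
- rewrite -mulrBl -Rintegral_itv_cst //; apply: le_Rintegral_itv => //.
    exact: cont_on_cst.
  by move=> x /H /andP[].
- rewrite -mulrDl -Rintegral_itv_cst //; apply: le_Rintegral_itv => //.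
    exact: cont_on_cst.
  by move=> x /H /andP[].
Qed.
Lemma diff1_cont (f : R -> R) (x A : R) :
  (forall e : R, 0 < e -> exists2 d : R, 0 < d & forall h, `|h| < d ->
     `|f (x + h) - f x - A * h| <= e * `|h|) -> {for x, continuous f}.
Proof.
move=> H; apply/cvgrPdist_le => e e0.
have [d d0 Hd] := H 1 ltr01.
have c0 : 0 < 1 + `|A| by rewrite ltr_pwDl.
near=> t.
have td : `|t - x| < d.
  near: t; apply/nbhs_ballP; exists d => //= t; rewrite /ball /= distrC; exact.
have te : `|t - x| < e / (1 + `|A|).
  near: t; apply/nbhs_ballP; exists (e / (1 + `|A|)) => //=; first by rewrite divr_gt0.
  by move=> t; rewrite /ball /= distrC; exact.
have := Hd _ td; rewrite [x + _]addrC subrK mul1r => Ht.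
rewrite distrC.
have -> : f t - f x = (f t - f x - A * (t - x)) + A * (t - x) by ring.
apply: (le_trans (ler_normD _ _)); rewrite normrM.
rewrite ltr_pdivlMr // in te.
by move: Ht te; nra.
Unshelve. all: by end_near. Qed.

End itv_int.

(** * Goursat's theorem for rectangles *)

Section goursat.
Variable R : realType.
Local Notation mu := (@lebesgue_measure R).
Variables u v : R -> R -> R.

(** Total differentiability with a derivative of Cauchy-Riemann form.  The
    derivative is not assumed to be continuous, which is why the theorem below
    needs a subdivision argument. *)
Definition cauchy_riemann_at x y := exists A B : R, forall e : R, 0 < e ->
  exists2 d : R, 0 < d & forall h k, `|h| < d -> `|k| < d ->
   `|u (x + h) (y + k) - u x y - (A * h - B * k)| <= e * (`|h| + `|k|) /\
   `|v (x + h) (y + k) - v x y - (B * h + A * k)| <= e * (`|h| + `|k|).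

Lemma cr_contx x y : cauchy_riemann_at x y ->
  {for x, continuous (u ^~ y)} /\ {for x, continuous (v ^~ y)}.
Proof.
move=> [A [B H]]; split.
- apply: (@diff1_cont _ _ _ A) => e /H[d d0 Hd]; exists d => // h hd.
  have [] := Hd h 0 hd; first by rewrite normr0.
  by rewrite !addr0 !mulr0 !subr0 normr0 addr0.
- apply: (@diff1_cont _ _ _ B) => e /H[d d0 Hd]; exists d => // h hd.
  have [] := Hd h 0 hd; first by rewrite normr0.
  by rewrite !addr0 !mulr0 !addr0 normr0 addr0.
Qed.

Lemma cr_conty x y : cauchy_riemann_at x y ->
  {for y, continuous (u x)} /\ {for y, continuous (v x)}.
Proof.
move=> [A [B H]]; split.
- apply: (@diff1_cont _ _ _ (- B)) => e /H[d d0 Hd]; exists d => // h hd.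
  have [] := Hd 0 h _ hd; first by rewrite normr0.
  by rewrite !addr0 !mulr0 !sub0r normr0 add0r mulNr.
- apply: (@diff1_cont _ _ _ A) => e /H[d d0 Hd]; exists d => // h hd.
  have [] := Hd 0 h _ hd; first by rewrite normr0.
  by rewrite !addr0 !mulr0 !add0r normr0 add0r.
Qed.

(** The imaginary part of the integral of [u + iv] along the boundary of the
    rectangle with lower left corner [p] and sides [h] and [k].  Its vertical
    sides carry the integral of u dy, which becomes a circular mean of the
    function. *)
Definition contour (p : R * R) (h k : R) : R :=
  \int[mu]_(y in `[p.2, p.2 + k]) u (p.1 + h) y - \int[mu]_(y in `[p.2, p.2 + k]) u p.1 y
  - (\int[mu]_(x in `[p.1, p.1 + h]) v x (p.2 + k) - \int[mu]_(x in `[p.1, p.1 + h]) v x p.2).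

Definition rect_cr (p : R * R) h k := forall x y,
  p.1 <= x <= p.1 + h -> p.2 <= y <= p.2 + k -> cauchy_riemann_at x y.

Lemma contour_quarters p h k : 0 <= h -> 0 <= k -> rect_cr p (h + h) (k + k) ->
  contour p (h + h) (k + k) = contour p h k + contour (p.1 + h, p.2) h k
   + contour (p.1, p.2 + k) h k + contour (p.1 + h, p.2 + k) h k.
Proof.
case: p => x y /= h0 k0 H; rewrite /contour /=.
have Hu x' : x <= x' <= x + (h + h) -> cont_on y (y + (k + k)) (u x').
  by move=> Hx y' Hy; apply: (cr_conty _).1; exact: H.
have Hv y' : y <= y' <= y + (k + k) -> cont_on x (x + (h + h)) (v ^~ y').
  by move=> Hy x' Hx; apply: (cr_contx _).2; exact: H.
have su x' : x <= x' <= x + (h + h) -> \int[mu]_(y' in `[y, y + (k + k)]) u x' y' =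
   \int[mu]_(y' in `[y, y + k]) u x' y' + \int[mu]_(y' in `[y + k, y + k + k]) u x' y'.
  move=> Hx; rewrite -addrA; apply: Rintegral_split; [lra|lra|exact: Hu].
have sv y' : y <= y' <= y + (k + k) -> \int[mu]_(x' in `[x, x + (h + h)]) v x' y' =
   \int[mu]_(x' in `[x, x + h]) v x' y' + \int[mu]_(x' in `[x + h, x + h + h]) v x' y'.
  move=> Hy; rewrite -addrA; apply: (@Rintegral_split _ (v ^~ y')); [lra|lra|exact: Hv].
rewrite !su ?sv; try lra.
rewrite !addrA.
by ring.
Qed.

(** The linear part contributes [A h k] from the vertical sides and the same from
    the horizontal ones, so only the error term is left. *)
Lemma contour_small p h k A B e x0 y0 : 0 <= h -> 0 <= k -> rect_cr p h k ->
  (forall x y, p.1 <= x <= p.1 + h -> p.2 <= y <= p.2 + k ->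
   `|u x y - u x0 y0 - (A * (x - x0) - B * (y - y0))| <= e /\
   `|v x y - v x0 y0 - (B * (x - x0) + A * (y - y0))| <= e) ->
  `|contour p h k| <= 2 * e * (h + k).
Proof.
case: p => x y /= h0 k0 H D; rewrite /contour /=.
have Hu x' : x <= x' <= x + h -> cont_on y (y + k) (u x').
  by move=> Hx y' Hy; apply: (cr_conty _).1; exact: H.
have Hv y' : y <= y' <= y + k -> cont_on x (x + h) (v ^~ y').
  by move=> Hy x' Hx; apply: (cr_contx _).2; exact: H.
have I1 := @Rintegral_diff_le _ (u (x + h)) (u x) y (y + k) (A * h) (2 * e).
have I2 := @Rintegral_diff_le _ (v ^~ (y + k)) (v ^~ y) x (x + h) (A * k) (2 * e).
have {}I1 := I1 _ _ _ _; have {}I2 := I2 _ _ _ _.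
have J1 : `|\int[mu]_(y' in `[y, y + k]) u (x + h) y' -
       \int[mu]_(y' in `[y, y + k]) u x y' - A * h * (y + k - y)| <= 2 * e * (y + k - y).
  apply: I1; [lra|apply: Hu; lra|apply: Hu; lra|].
  move=> y' Hy'.
  have [D1 _] := D (x + h) y' ltac:(lra) Hy'.
  have [D2 _] := D x y' ltac:(lra) Hy'.
  move: D1 D2; rewrite !ler_norml; lra.
have J2 : `|\int[mu]_(x' in `[x, x + h]) v x' (y + k) -
       \int[mu]_(x' in `[x, x + h]) v x' y - A * k * (x + h - x)| <= 2 * e * (x + h - x).
  apply: I2; [lra|apply: Hv; lra|apply: Hv; lra|].
  move=> x' Hx'.
  have [_ D1] := D x' (y + k) Hx' ltac:(lra).
  have [_ D2] := D x' y Hx' ltac:(lra).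
  move: D1 D2; rewrite !ler_norml; lra.
move: J1 J2; rewrite !ler_norml; lra.
Qed.

Lemma contour_child p h k : 0 <= h -> 0 <= k -> rect_cr p (h + h) (k + k) ->
  exists q, [/\ q = p \/ q = (p.1 + h, p.2) \/ q = (p.1, p.2 + k) \/ q = (p.1 + h, p.2 + k)
   & `|contour p (h + h) (k + k)| <= 4 * `|contour q h k|].
Proof.
move=> h0 k0 H; have E := contour_quarters h0 k0 H.
apply: contrapT => /forallNP N.
have N1 q : q = p \/ q = (p.1 + h, p.2) \/ q = (p.1, p.2 + k) \/ q = (p.1 + h, p.2 + k) ->
  4 * `|contour q h k| < `|contour p (h + h) (k + k)|.
  by move=> Hq; rewrite ltNge; apply/negP => Hc; apply: (N q); split.
have := N1 p ltac:(tauto).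
have := N1 (p.1 + h, p.2) ltac:(tauto).
have := N1 (p.1, p.2 + k) ltac:(tauto).
have := N1 (p.1 + h, p.2 + k) ltac:(tauto).
rewrite E.
set a := contour p h k; set b := contour (p.1 + h, p.2) h k.
set c := contour (p.1, p.2 + k) h k; set d := contour (p.1 + h, p.2 + k) h k.
have := ler_normD (a + b + c) d; have := ler_normD (a + b) c; have := ler_normD a b.
lra.
Qed.

(** If the integral were not 0, quartering the rectangle would give nested
    rectangles, the n-th one carrying at least 4^-n of the integral.  At their
    common point the derivative makes the n-th integral o(4^-n). *)
Lemma contour_eq0 p h k : 0 <= h -> 0 <= k -> rect_cr p h k -> contour p h k = 0.
Proof.
move=> h0 k0 H.
pose w (c : R) n : R := c / 2 ^+ n.
have wS c n : w c n = w c n.+1 + w c n.+1.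
  by rewrite /w exprS; field; rewrite expf_neq0.
have w0 c n : 0 <= c -> 0 <= w c n by move=> c0; rewrite divr_ge0 // exprn_ge0.
(* [good n q]: the rectangle at [q] of size (h, k) / 2^n lies in the given one
   and carries at least 4^-n of its integral. *)
pose good n (q : R * R) := [/\ p.1 <= q.1, q.1 + w h n <= p.1 + h,
  p.2 <= q.2, q.2 + w k n <= p.2 + k & `|contour p h k| <= 4 ^+ n * `|contour q (w h n) (w k n)|].
have good_cr n q : good n q -> rect_cr q (w h n) (w k n).
  by move=> [? ? ? ? _] x y /andP[? ?] /andP[? ?]; apply: H; lra.
have step n q : exists q', good n q -> [/\ good n.+1 q', q.1 <= q'.1, q'.1 + w h n.+1 <= q.1 + w h n,
    q.2 <= q'.2 & q'.2 + w k n.+1 <= q.2 + w k n].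
  have [g|ng] := pselect (good n q); last by exists q.
  have cr := good_cr _ _ g.
  have hn := w0 h n.+1 h0; have kn := w0 k n.+1 k0.
  rewrite (wS h n) (wS k n) in cr; have [q' [Hq' Hc]] := contour_child hn kn cr.
  exists q' => _; case: g => g1 g2 g3 g4 g5; rewrite (wS h n) (wS k n) in g2 g4 g5 *.
  have g5' : `|contour p h k| <= 4 ^+ n.+1 * `|contour q' (w h n.+1) (w k n.+1)|.
    apply: (le_trans g5); by rewrite exprSr -mulrA ler_wpM2l // exprn_ge0.
  have Eh := wS h n; have Ek := wS k n.
  have q'1 : q.1 <= q'.1 <= q.1 + w h n.+1 by move: Hq' => [->|[->|[->|->]]] /=; lra.
  have q'2 : q.2 <= q'.2 <= q.2 + w k n.+1 by move: Hq' => [->|[->|[->|->]]] /=; lra.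
  move: q'1 q'2 => /andP[q'1 q'1'] /andP[q'2 q'2'].
  by clear H cr Hq' Hc g5; (do ?split) => //; lra.
have [nx nxP] := choice (fun nq : nat * (R * R) => step nq.1 nq.2).
pose s := fix s n := if n is m.+1 then nx (m, s m) else p.
have sgood n : good n (s n).
  elim: n => [|n ih]; last by have [] := nxP (n, s n) ih.
  by split; rewrite /w ?expr0 ?divr1 ?mul1r.
have sS n : [/\ (s n).1 <= (s n.+1).1, (s n.+1).1 + w h n.+1 <= (s n).1 + w h n,
    (s n).2 <= (s n.+1).2 & (s n.+1).2 + w k n.+1 <= (s n).2 + w k n].
  by have [] := nxP (n, s n) (sgood n).
have mono n m : (n <= m)%N -> [/\ (s n).1 <= (s m).1, (s m).1 + w h m <= (s n).1 + w h n,
    (s n).2 <= (s m).2 & (s m).2 + w k m <= (s n).2 + w k n].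
  move=> /subnK <-; elim: (m - n)%N => [|i [a1 a2 a3 a4]]; first by rewrite add0n.
  by have [b1 b2 b3 b4] := sS (i + n)%N; rewrite addSn; split; lra.
have nest (f : nat -> R) (c : R) : (forall n m, (n <= m)%N -> f n <= f m /\ f m + w c m <= f n + w c n) ->
   0 <= c -> exists z, forall n, f n <= z <= f n + w c n.
  move=> Hf c0; exists (sup (range f)) => n.
  have ub m : ubound (range f) (f m + w c m).
    move=> _ [i _ <-]; have := w0 c i c0; have := w0 c m c0.
    have [/Hf[]|/ltnW/Hf[]] := leqP i m; lra.
  apply/andP; split.
    apply: ub_le_sup; last by exists n.
    by exists (f 0%N + w c 0%N); exact: ub.
  by apply: ge_sup; [exists (f 0%N); exists 0%N|exact: ub].
have [|x0 x0P] := nest (fun n => (s n).1) h _ h0; first by move=> n m /mono[].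
have [|y0 y0P] := nest (fun n => (s n).2) k _ k0; first by move=> n m /mono[].
have [A [B D]] : cauchy_riemann_at x0 y0.
  by apply: (good_cr 0%N (s 0%N) (sgood 0%N)); rewrite ?x0P ?y0P.
apply/eqP; rewrite -normr_le0; apply/ler_addgt0Pl => e e0; rewrite addr0.
pose e' := e / (2 * (h + k) ^+ 2 + 1).
have den0 : 0 < 2 * (h + k) ^+ 2 + 1 by rewrite ltr_wpDl // mulr_ge0 // sqr_ge0.
have e'0 : 0 < e' by rewrite divr_gt0.
have [d d0 Hd] := D _ e'0.
have [n wn] : exists n, w h n < d /\ w k n < d.
  have [n Hn] : exists n : nat, (h + k + 1) / d < n%:R.
    by exists (Num.truncn ((h + k + 1) / d)).+1; apply: truncnS_gt.
  exists n; suff : (h + k + 1) < d * 2 ^+ n.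
    have t0 : 0 < 2 ^+ n :> R by rewrite exprn_gt0.
    by move=> Hlt; rewrite /w !ltr_pdivrMr //; split; lra.
  rewrite ltr_pdivrMr // in Hn; apply: (lt_le_trans Hn); rewrite mulrC ler_pM2l //.
  by rewrite -natrX ler_nat ltnW // ltn_expl.
have [wh wk] := wn; have hn := w0 h n h0; have kn := w0 k n k0.
have S := @contour_small (s n) (w h n) (w k n) A B (e' * (w h n + w k n)) x0 y0 hn kn (good_cr _ _ (sgood n)).
have {}S : `|contour (s n) (w h n) (w k n)| <= 2 * (e' * (w h n + w k n)) * (w h n + w k n).
  apply: S => x y Hx Hy.
  have Hx0 := x0P n; have Hy0 := y0P n.
  have ax : `|x - x0| <= w h n by rewrite ler_norml; lra.
  have ay : `|y - y0| <= w k n by rewrite ler_norml; lra.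
  have [] := Hd (x - x0) (y - y0); [lra|lra|].
  rewrite ![_ + (_ - _)]addrC !subrK => h1 h2.
  have le : e' * (`|x - x0| + `|y - y0|) <= e' * (w h n + w k n).
    by rewrite ler_pM2l //; lra.
  by split; [apply: le_trans h1 le|apply: le_trans h2 le].
have [_ _ _ _ G] := sgood n.
apply: (le_trans G).
have t0 : 0 < 2 ^+ n :> R by rewrite exprn_gt0.
have -> : (4 : R) ^+ n = 2 ^+ n * 2 ^+ n.
  by rewrite -exprMn; congr (_ ^+ _); ring.
apply: (@le_trans _ _ (2 * e' * (h + k) ^+ 2)).
  apply: (@le_trans _ _ (2 ^+ n * 2 ^+ n * (2 * (e' * (w h n + w k n)) * (w h n + w k n)))).
    by rewrite ler_pM2l // mulr_gt0.
  rewrite le_eqVlt; apply/orP; left; apply/eqP; rewrite /w; field.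
  by rewrite lt0r_neq0.
rewrite /e' mulrAC mulrA ler_pdivrMr //; nra.
Qed.

End goursat.

(** * The modulus and the unit circle *)

Section normc_facts.
Variable R : realType.
Local Notation C := R[i].
Implicit Types (z w : C).

Lemma normc_sqr z : normc z ^+ 2 = complex.Re z ^+ 2 + complex.Im z ^+ 2.
Proof. by case: z => a b /=; rewrite sqr_sqrtr // addr_ge0 ?sqr_ge0. Qed.

Lemma normc_ge0 z : 0 <= normc z.
Proof. by case: z => a b /=; exact: sqrtr_ge0. Qed.

Lemma normc_le_sqr z w : (normc z <= normc w) = (normc z ^+ 2 <= normc w ^+ 2).
Proof. by rewrite ler_sqr ?nnegrE ?normc_ge0. Qed.

Lemma Re_le_normc z : `|complex.Re z| <= normc z.
Proof.
rewrite -ler_sqr ?nnegrE ?normc_ge0 // normc_sqr real_normK ?num_real //.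
by rewrite lerDl sqr_ge0.
Qed.

Lemma Im_le_normc z : `|complex.Im z| <= normc z.
Proof.
rewrite -ler_sqr ?nnegrE ?normc_ge0 // normc_sqr real_normK ?num_real //.
by rewrite lerDr sqr_ge0.
Qed.

Lemma normc_le_ReIm z : normc z <= `|complex.Re z| + `|complex.Im z|.
Proof.
rewrite -ler_sqr ?nnegrE ?normc_ge0 ?addr_ge0 // normc_sqr sqrrD.
rewrite !real_normK ?num_real // lerD2r lerDl mulrn_wge0 // mulr_ge0 //.
Qed.

Lemma normc_conj z : normc z^* = normc z.
Proof. by case: z => a b /=; rewrite sqrrN. Qed.

Lemma normcX z n : normc (z ^+ n) = normc z ^+ n.
Proof. by elim: n => [|n ih]; [rewrite !expr0 normc1|rewrite !exprS normcM ih]. Qed.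

Lemma normc_real (r : R) : normc r%:C = `|r|.
Proof. by rewrite /= expr0n addr0 sqrtr_sqr. Qed.

Lemma normc_gt0 z : (0 < normc z) = (z != 0).
Proof.
rewrite lt0r normc_ge0 andbT; congr negb; apply/eqP/eqP => [/eq0_normc//|->].
by rewrite normc0.
Qed.

Lemma ler_normcB z w : normc z - normc w <= normc (z - w).
Proof. by rewrite lerBlDr -{1}(subrK w z); exact: le_normcD. Qed.

Definition cis (t : R) : C := cos t +i* sin t.

Lemma normc_cis t : normc (cis t) = 1.
Proof. by rewrite /cis /= cos2Dsin2 sqrtr1. Qed.

Lemma cisD s t : cis (s + t) = cis s * cis t.
Proof. by rewrite /cis cosD sinD; apply/eqP; rewrite eq_complex /=; apply/andP; split; apply/eqP; ring. Qed.


Lemma cis_surj z : normc z = 1 -> exists2 t, 0 <= t <= pi *+ 2 & z = cis t.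
Proof.
move=> z1; have := normc_sqr z; rewrite z1 expr1n => E.
have rz : -1 <= complex.Re z <= 1.
  by rewrite -ler_norml -z1; exact: Re_le_normc.
have rz' : complex.Re z \in `[-1, 1] by rewrite in_itv.
have a0 := acos_ge0 rz; have api := acos_lepi rz.
have s : sin (acos (complex.Re z)) = `|complex.Im z|.
  rewrite sin_acos // -sqrtr_sqr; congr Num.sqrt.
  by rewrite E addrAC subrr add0r.
have pi0 : 0 <= pi :> R := pi_ge0 R.
have [i0|i0] := leP 0 (complex.Im z).
- exists (acos (complex.Re z)); first by rewrite a0 mulr2n; lra.
  by rewrite /cis acosK // s ger0_norm //; case: (z).
- exists (pi *+ 2 - acos (complex.Re z)); first by rewrite mulr2n; lra.
  rewrite /cis [_ *+ 2 - _]addrC cosD2pi sinD2pi cosN sinN acosK // s.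
  by rewrite ltr0_norm // opprK; case: (z).
Qed.
End normc_facts.

(** * The complex exponential *)

Section cexp.
Variable R : realType.
Local Notation C := R[i].

Definition cexp (z : C) : C := (expR (complex.Re z))%:C * cis (complex.Im z).

Lemma cexpD (z w : C) : cexp (z + w) = cexp z * cexp w.
Proof.
case: z w => [a b] [c d]; rewrite /cexp /= expRD cisD rmorphM.
by rewrite -!mulrA; congr (_ * _); rewrite mulrCA.
Qed.

Lemma normc_cexp (z : C) : normc (cexp z) = expR (complex.Re z).
Proof. by rewrite /cexp normcM normc_cis mulr1 normc_real ger0_norm // expR_ge0. Qed.

Lemma derive_eps (f : R -> R) (x d : R) : is_derive x 1 f d ->
  forall e : R, 0 < e -> exists2 del : R, 0 < del & forall h, `|h| < del ->
   `|f (x + h) - f x - d * h| <= e * `|h|.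
Proof.
move=> [df dE] e e0.
have : (fun h : R => h^-1 *: ((f \o shift x) (h%:A) - f x)) @ 0^' --> d.
  by rewrite -dE; exact: df.
move=> /cvgrPdist_le /(_ e e0) /nbhs_ballP[del del0 Hd].
exists del => // h hd.
have [->|h0] := eqVneq h 0.
  by rewrite addr0 mulr0 subrr subr0 !normr0 mulr0.
have /= := Hd h.
rewrite /ball /= sub0r normrN => /(_ hd h0).
rewrite -(ler_pM2r (_ : 0 < `|h|)) ?normr_gt0 //.
rewrite -normrM; apply: le_trans; rewrite le_eqVlt; apply/orP; left; apply/eqP.
rewrite -normrN; congr `| _ |.
rewrite /GRing.scale /= mulrBl mulrAC mulVf // mul1r mulr1 [h + x]addrC.
by rewrite opprB.
Qed.

(** Differentiability of the exponential at 0; the functional equation [cexpD]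
    carries it to every other point. *)
Lemma cexp_eps (e : R) : 0 < e -> exists2 del : R, 0 < del & forall h : C,
  normc h < del -> normc (cexp h - 1 - h) <= e * normc h.
Proof.
move=> e0.
(* Errors of relative size [e1] in exp, cos and sin add up to at most 7 e1 |h|. *)
pose e1 := Num.min (e / 10) 2^-1.
have e10 : 0 < e1 by rewrite lt_min divr_gt0 //= invr_gt0.
have e1e : e1 <= e / 10 by rewrite ge_min lexx.
have e12 : e1 <= 2^-1 by rewrite ge_min lexx orbT.
clearbody e1.
have [d1 d10 H1] := @derive_eps expR 0 _ (is_derive_expR 0) e1 e10.
have [d2 d20 H2] := @derive_eps cos 0 _ (is_derive_cos 0) e1 e10.
have [d3 d30 H3] := @derive_eps sin 0 _ (is_derive_sin 0) e1 e10.
exists (Num.min (Num.min d1 d2) (Num.min d3 e1)).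
  by rewrite !lt_min d10 d20 d30 e10.
move=> h; rewrite !lt_min => /andP[/andP[h1 h2] /andP[h3 h4]].
have hx := Re_le_normc h; have hy := Im_le_normc h.
have n0 := normc_ge0 h.
set x := complex.Re h in hx *; set y := complex.Im h in hy *.
have := H1 x (le_lt_trans hx h1); have := H2 y (le_lt_trans hy h2).
have := H3 y (le_lt_trans hy h3).
rewrite !add0r expR0 sin0 cos0 !subr0 oppr0 mul0r !mul1r !subr0.
set r1 := expR x - 1 - x; set r2 := cos y - 1; set r3 := sin y - y => R3 R2 R1.
apply: (le_trans (normc_le_ReIm _)).
have -> : complex.Re (cexp h - 1 - h) = r1 + r2 * (1 + x + r1).
  rewrite /cexp /cis /r1 /r2 /x /y; case: (h) => a b /=; ring.
have -> : complex.Im (cexp h - 1 - h) = (x + r1) * y + (1 + x + r1) * r3.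
  rewrite /cexp /cis /r1 /r3 /x /y; case: (h) => a b /=; ring.
have x1 : `|x| <= e1 by lra.
have y1 : `|y| <= e1 by lra.
have r11 : `|r1| <= `|x| by apply: (le_trans R1); apply: ler_piMl => //; lra.
have big : `|1 + x + r1| <= 2.
  have := ler_normD (1 + x) r1; have := ler_normD 1 x; rewrite normr1; lra.
have A1 : `|r1 + r2 * (1 + x + r1)| <= e1 * normc h * 3.
  apply: (le_trans (ler_normD _ _)); rewrite normrM.
  have : `|r2| * `|1 + x + r1| <= (e1 * `|y|) * 2 by apply: ler_pM.
  nra.
have A2 : `|(x + r1) * y + (1 + x + r1) * r3| <= e1 * normc h * 4.
  apply: (le_trans (ler_normD _ _)); rewrite !normrM.
  have : `|1 + x + r1| * `|r3| <= 2 * (e1 * `|y|) by apply: ler_pM.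
  have : `|x + r1| * `|y| <= (2 * e1) * `|y|.
    by apply: ler_pM => //; have := ler_normD x r1; lra.
  nra.
nra.
Qed.

Lemma holo_cexp (z : C) : holo cexp z.
Proof.
apply/holoP; exists (cexp z) => e e0.
have [|del del0 H] := @cexp_eps (e / normc (cexp z)).
  by rewrite divr_gt0 // normc_cexp expR_gt0.
exists del => // h hd.
have -> : cexp (z + h) - cexp z - cexp z * h = cexp z * (cexp h - 1 - h).
  by rewrite cexpD; ring.
rewrite normcM; have := H h hd; rewrite mulrAC ler_pdivlMr ?normc_cexp ?expR_gt0 //.
by rewrite mulrC.
Qed.

Lemma holo_cauchy_riemann (G : C -> C) (x y : R) : holo G (x +i* y) ->
  cauchy_riemann_at (fun x y => complex.Re (G (x +i* y)))
    (fun x y => complex.Im (G (x +i* y))) x y.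
Proof.
move=> /holoP[[A B] H]; exists A, B => e e0.
have [del del0 Hd] := H _ e0.
exists (del / 2); first by rewrite divr_gt0.
move=> h k hd kd.
have hk : normc (h +i* k) <= `|h| + `|k| by exact: (normc_le_ReIm (h +i* k)).
have {}Hd := Hd (h +i* k) ltac:(lra).
have {}Hd : normc (G ((x + h) +i* (y + k)) - G (x +i* y) - (A +i* B) * (h +i* k)) <= e * (`|h| + `|k|).
  by apply: (le_trans Hd); rewrite ler_pM2l.
split.
- apply: le_trans Hd; apply: le_trans (Re_le_normc _).
  by move: (G _) (G _) => [a b] [c d] /=; rewrite lexx.
- apply: le_trans Hd; apply: le_trans (Im_le_normc _).
  by move: (G _) (G _) => [a b] [c d] /=; rewrite [B * h + _]addrC lexx.
Qed.
End cexp.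

(** * The maximum principle *)

Section maximum_principle.
Variable R : realType.
Local Notation C := R[i].
Local Notation mu := (@lebesgue_measure R).

Lemma holo_cont_eps (F : C -> C) z (e : R) : holo F z -> 0 < e ->
  exists2 d : R, 0 < d & forall h, normc h < d -> normc (F (z + h) - F z) <= e.
Proof.
move=> /holoP[D H] e0; have [d d0 Hd] := H 1 ltr01.
exists (Num.min d (e / (1 + normc D))).
  by rewrite lt_min d0 divr_gt0 // ltr_pwDl // normc_ge0.
move=> h; rewrite lt_min => /andP[hd he].
have D0 := normc_ge0 D.
rewrite ltr_pdivlMr ?ltr_pwDl // in he.
rewrite -(subrK (D * h) (F (z + h) - F z)).
apply: (le_trans (le_normcD _ _)); rewrite normcM.
have := Hd _ hd; nra.
Qed.

(** Goursat's theorem for F(e^w) on the rectangle [x, 0] x [0, 2 pi]: the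
    horizontal sides cancel by periodicity, so the mean of Re F over the circle
    of radius e^x is the mean over the unit circle, and it tends to Re F(0) as x
    tends to minus infinity. *)
Lemma re_maximum_principle (F : C -> C) (c : R) :
  (forall z, normc z <= 1 -> holo F z) ->
  (forall t, complex.Re (F (cis t)) <= c) -> complex.Re (F 0) <= c.
Proof.
move=> hF Fc; rewrite leNgt; apply/negP => cF.
pose e := (complex.Re (F 0) - c) / 2.
have e0 : 0 < e by rewrite divr_gt0 // subr_gt0.
have [|d d0 Hd] := @holo_cont_eps F 0 e (hF 0 _) e0; first by rewrite normc0.
have [x [x0 xd]] : exists x : R, x < 0 /\ expR x < d.
  pose d' := Num.min (d / 2) (2^-1).
  have d'0 : 0 < d' by rewrite lt_min divr_gt0 //= invr_gt0.
  exists (ln d'); split.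
    rewrite ln_lt0 // d'0 /=; apply: (@le_lt_trans _ _ 2^-1).
      by rewrite ge_min lexx orbT.
    by rewrite invf_lt1 // ltr1n.
  rewrite lnK //; apply: (@le_lt_trans _ _ (d / 2)); first by rewrite ge_min lexx.
  by rewrite ltr_pdivrMr // ltr_pMr // ltr1n.
pose G := F \o @cexp R.
have hG a b : a <= 0 -> holo G (a +i* b).
  move=> a0; apply: holo_comp; first exact: holo_cexp.
  by apply: hF; rewrite normc_cexp /= expR_le1.
pose u a b := complex.Re (G (a +i* b)).
pose v a b := complex.Im (G (a +i* b)).
have CR a b : a <= 0 -> cauchy_riemann_at u v a b.
  by move=> a0; apply: holo_cauchy_riemann; exact: hG.
have [T [T0 cT sT]] : exists T : R, [/\ 0 < T, cos T = 1 & sin T = 0].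
  by exists (pi *+ 2); rewrite cos2pi sin2pi mulrn_wgt0 // pi_gt0.
have v_period : v ^~ T = v ^~ 0.
  by apply/funext => a; rewrite /v /G /cexp /cis /= cT sT cos0 sin0.
have u_circle t : u 0 t <= c by rewrite /u /G /cexp /= expR0 mul1r; exact: Fc.
have u_center t : c + e <= u x t.
  have := Hd (cexp (x +i* t)); rewrite normc_cexp add0r => /(_ xd).
  have := Re_le_normc (F (cexp (x +i* t)) - F 0).
  rewrite raddfB /= => A B; have {A B} := le_trans A B.
  by rewrite ler_norml /e => /andP[A _]; move: A; rewrite /u /G /=; lra.
(* From here on only these facts about u and v matter. *)
move: u v CR v_period u_circle u_center => u v CR v_period u_circle u_center.
have := @contour_eq0 R u v (x, 0) (- x) T.
rewrite oppr_ge0 (ltW x0) (ltW T0) => /(_ isT isT).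
have RC : rect_cr u v (x, 0) (- x) T by move=> a b /= Ha _; apply: CR; lra.
move=> /(_ RC); rewrite /contour /= subrr add0r v_period subrr subr0.
move=> /eqP; rewrite subr_eq0 => /eqP E.
have cu a : a <= 0 -> cont_on 0 T (u a).
  by move=> a0 b _; apply: (cr_conty (CR a b a0)).1.
have U0 : \int[mu]_(y in `[0, T]) u 0 y <= c * (T - 0).
  rewrite -Rintegral_itv_cst ?(ltW T0) //.
  by apply: le_Rintegral_itv => // [|]; [exact: cu|exact: cont_on_cst].
have Ux : (c + e) * (T - 0) <= \int[mu]_(y in `[0, T]) u x y.
  rewrite -Rintegral_itv_cst ?(ltW T0) //.
  by apply: le_Rintegral_itv => // [|]; [exact: cont_on_cst|apply: cu; exact: ltW].
have := le_trans Ux (le_trans _ U0); rewrite E => /(_ (lexx _)).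
by rewrite subr0 ler_pM2r // gerDl leNgt e0.
Qed.

(** The automorphism of the disc that sends 0 to [b]. *)
Definition mobius (b z : C) : C := (z + b) / (1 + b^* * z).

Lemma mobius_den (b z : C) : normc b < 1 -> normc z <= 1 -> 1 + b^* * z != 0.
Proof.
move=> b1 z1; rewrite -normc_gt0.
have := ler_normcB 1 (- (b^* * z)); rewrite opprK normcN normcM normc_conj normc1.
have := normc_ge0 b; have := normc_ge0 z; nra.
Qed.

Lemma normc_mobius (b z : C) : normc b < 1 -> normc z <= 1 -> normc (mobius b z) <= 1.
Proof.
move=> b1 z1; rewrite /mobius normcM normcV ler_pdivrMr ?normc_gt0 ?mobius_den // mul1r.
rewrite normc_le_sqr !normc_sqr.
have := normc_ge0 b; have := normc_ge0 z.
have : normc b ^+ 2 < 1 by rewrite expr_lt1 // normc_ge0.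
have : normc z ^+ 2 <= 1 by rewrite expr_le1 // normc_ge0.
rewrite !normc_sqr; case: b z {b1 z1} => [a b] [c d] /=; nra.
Qed.

Lemma normc_mobius1 (b z : C) : normc b < 1 -> normc z = 1 -> normc (mobius b z) = 1.
Proof.
move=> b1 z1; rewrite /mobius normcM normcV.
have den : 0 < normc (1 + b^* * z) by rewrite normc_gt0 mobius_den // z1.
suff -> : normc (z + b) = normc (1 + b^* * z) by rewrite divff // lt0r_neq0.
apply/eqP; rewrite -(@eqrXn2 _ 2) ?normc_ge0 // -subr_eq0.
have := normc_sqr z; rewrite z1 expr1n => /esym E.
rewrite !normc_sqr; case: b z E {b1 z1 den} => [a b] [c d] /= E.
have -> : (c + a) ^+ 2 + (d + b) ^+ 2 - ((1 + (a * c - - b * d)) ^+ 2 + (0 + (a * d + - b * c)) ^+ 2)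
  = (c ^+ 2 + d ^+ 2 - 1) * (1 - a ^+ 2 - b ^+ 2) by ring.
by rewrite E subrr mul0r.
Qed.

Lemma holo_mobius (b z : C) : normc b < 1 -> normc z <= 1 -> holo (mobius b) z.
Proof.
move=> b1 z1; apply: holoM; first by apply: holoD; [exact: holo_id|exact: holo_cst].
apply: holoV; first exact: mobius_den.
by apply: holoD; [exact: holo_cst|apply: holoM; [exact: holo_cst|exact: holo_id]].
Qed.

(** The Moebius map moves [b] to 0, and the factor conj(F(b)) turns the modulus
    into a real part. *)
Lemma maximum_modulus (F : C -> C) (b : C) (c : R) :
  (forall z, normc z <= 1 -> holo F z) ->
  (forall z, normc z = 1 -> normc (F z) <= c) -> normc b < 1 -> normc (F b) <= c.
Proof.
move=> hF Fc b1.
have c0 : 0 <= c by apply: le_trans (Fc 1 (normc1 R)); exact: normc_ge0.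
pose K z := (F b)^* * F (mobius b z).
have K0 : complex.Re (K 0) = normc (F b) ^+ 2.
  rewrite /K /mobius mulr0 addr0 add0r divr1 normc_sqr.
  by case: (F b) => x y /=; ring.
have := @re_maximum_principle K (normc (F b) * c).
rewrite K0 => H; have {}H : normc (F b) ^+ 2 <= normc (F b) * c.
  apply: H => [z z1|t].
    apply: holoM; first exact: holo_cst.
    by apply: (@holo_comp _ F); [exact: holo_mobius|apply: hF; exact: normc_mobius].
  apply: le_trans (le_trans (ler_norm _) (Re_le_normc _)) _.
  rewrite normcM normc_conj ler_wpM2l ?normc_ge0 //; apply: Fc.
  by rewrite normc_mobius1 // normc_cis.
have := normc_ge0 (F b); rewrite le_eqVlt => /predU1P[<- //|p].
by move: H; rewrite expr2 ler_pM2l.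
Qed.

End maximum_principle.

(** * Powers of analytic functions: the circular mean bounds interior values *)

Section growth.
Variable R : realType.
Local Notation C := R[i].
Local Notation mu := (@lebesgue_measure R).

Lemma bernoulli_ineq (x : R) n : 0 <= x -> 1 + n%:R * x <= (1 + x) ^+ n.
Proof.
move=> x0; elim: n => [|n ih]; first by rewrite mul0r addr0 expr0.
rewrite exprS -natr1.
have n0 : 0 <= n%:R :> R by [].
have : (1 + x) * (1 + n%:R * x) <= (1 + x) * (1 + x) ^+ n by rewrite ler_wpM2l // addr_ge0.
have : 0 <= n%:R * x * x by rewrite !mulr_ge0.
nra.
Qed.

(** Otherwise (X/Y)^n would be unbounded.  This makes the constants that arise
    from rounding n/p disappear as n tends to infinity. *)
Lemma le_of_expr_le (X Y K : R) : 0 <= X -> 0 < Y ->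
  (forall n, X ^+ n <= K * Y ^+ n) -> X <= Y.
Proof.
move=> X0 Y0 H; rewrite leNgt; apply/negP => YX.
pose d := X / Y - 1.
have d0 : 0 < d by rewrite subr_gt0 ltr_pdivlMr // mul1r.
have Hn n : 1 + n%:R * d <= K.
  apply: (le_trans (bernoulli_ineq n (ltW d0))).
  by rewrite /d addrC subrK expr_div_n ler_pdivrMr ?exprn_gt0.
have := Hn (Num.truncn (K / d)).+1.
have := truncnS_gt (K / d); rewrite ltr_pdivrMr //; lra.
Qed.

(** The two powers differ by the factor x^th with 0 <= th < 1. *)
Lemma power_truncn_bounds (l L x s : R) : 0 < l -> l <= 1 -> 1 <= L -> l <= x <= L -> 0 <= s ->
  x ^+ Num.truncn s * l <= x `^ s <= x ^+ Num.truncn s * L.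
Proof.
move=> l0 l1 L1 /andP[lx xL] s0.
have x0 : 0 < x by apply: lt_le_trans lx.
have /andP[t1 t2] := truncn_itv s0.
set m := Num.truncn s in t1 t2 *.
pose th := s - m%:R.
have th0 : 0 <= th by rewrite subr_ge0.
have th1 : th <= 1 by rewrite lerBlDr addrC natr1 ltW.
have -> : x `^ s = x ^+ m * x `^ th.
  by rewrite -powR_mulrn ?(ltW x0) // -powRD ?(gt_eqF x0) ?implybT // /th addrC subrK.
rewrite !ler_pM2l ?exprn_gt0 //.
have [x1|x1] := leP x 1.
- have xx : 0 < x <= 1 by rewrite x0.
  rewrite (le_trans lx) ?ger1_powR //=; apply: le_trans L1.
  by rewrite -(powRr0 x) ger_powR.
- rewrite (le_trans (ler1_powR (ltW x1) th1)) // andbT.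
  apply: (le_trans l1); rewrite -(powRr0 x); apply: ler_powR => //; exact: ltW.
Qed.

(** A root Phi^(1/p) would compare directly with F, but for general p it needs
    a branch of the logarithm.  Instead, the maximum modulus principle is applied
    to F^n / Phi^m with m the integer part of n/p.  Rounding costs a factor
    between l and L on both sides, uniformly in n, and disappears on taking n-th
    roots. *)
Lemma holo_power_majorant (F Phi : C -> C) (p l L : R) (b : C) : 0 < p -> 0 < l ->
  (forall z, normc z <= 1 -> holo F z /\ holo Phi z /\ l <= normc (Phi z) <= L) ->
  (forall z, normc z = 1 -> normc (F z) `^ p <= normc (Phi z)) -> normc b < 1 ->
  normc (F b) `^ p <= normc (Phi b).
Proof.
move=> p0 l0 H FP b1.
pose l' := Num.min 1 l; pose L' := Num.max 1 L.
have l'0 : 0 < l' by rewrite lt_min l0 ltr01.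
have l'1 : l' <= 1 by rewrite ge_min lexx.
have L'1 : 1 <= L' by rewrite le_max lexx.
have P z : normc z <= 1 -> l' <= normc (Phi z) <= L'.
  by move=> /H[_ [_ /andP[A B]]]; rewrite ge_min A orbT /= le_max B orbT.
have Pb := P b (ltW b1).
have Pb0 : 0 < normc (Phi b) by case/andP: Pb => + _; exact: lt_le_trans.
suff : normc (F b) <= normc (Phi b) `^ p^-1.
  move=> /(ge0_ler_powR (ltW p0)); rewrite -powRrM mulVf ?lt0r_neq0 // powRr1 ?normc_ge0 //.
  by apply; rewrite nnegrE ?powR_ge0 ?normc_ge0.
apply: (@le_of_expr_le _ _ (L' / l')); [exact: normc_ge0|exact: powR_gt0|move=> n].
pose s := n%:R / p; have s0 : 0 <= s by rewrite divr_ge0 // ltW.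
pose m := Num.truncn s.
have Hb : normc (F b ^+ n * (Phi b ^+ m)^-1) <= L'.
  apply: (@maximum_modulus R (fun z => F z ^+ n * (Phi z ^+ m)^-1)) => // z z1.
    have [hF [hP _]] := H z z1; have := P z z1 => /andP[lP _].
    apply: holoM; first exact: holoX.
    apply: holoV; last exact: holoX.
    by rewrite expf_neq0 // -normc_gt0 (lt_le_trans l'0).
  have Pz : l' <= normc (Phi z) <= L' by apply: P; rewrite z1.
  have Pz0 : 0 < normc (Phi z) by case/andP: Pz => + _; exact: lt_le_trans.
  rewrite normcM normcV !normcX ler_pdivrMr ?exprn_gt0 //.
  have /andP[_] := power_truncn_bounds l'0 l'1 L'1 Pz s0.
  rewrite -/m mulrC; apply: le_trans.
  have -> : normc (F z) ^+ n = (normc (F z) `^ p) `^ s.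
    by rewrite -powRrM /s mulrCA divff ?lt0r_neq0 // mulr1 powR_mulrn ?normc_ge0.
  by apply: ge0_ler_powR => //; rewrite ?nnegrE ?powR_ge0 ?normc_ge0 //; exact: FP.
move: Hb; rewrite normcM normcV !normcX ler_pdivrMr ?exprn_gt0 // => /le_trans; apply.
have E : normc (Phi b) `^ s = (normc (Phi b) `^ p^-1) ^+ n.
  by rewrite -powR_mulrn ?powR_ge0 // -powRrM /s mulrC.
have /andP[Hm _] := power_truncn_bounds l'0 l'1 L'1 Pb s0.
rewrite -/m E in Hm.
by rewrite -mulrA ler_pM2l ?(lt_le_trans ltr01) // [l'^-1 * _]mulrC ler_pdivlMr.
Qed.

Lemma powR_cont (g : R -> R) (t p : R) : 0 < p -> (forall s, 0 <= g s) ->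
  {for t, continuous g} -> {for t, continuous (fun s => g s `^ p)}.
Proof.
move=> p0 g0 cg; have := g0 t; rewrite le_eqVlt => /predU1P[gt|gt].
- apply/cvgrPdist_le => e e0; rewrite -gt powR0 ?lt0r_neq0 //.
  have d0 : 0 < e `^ p^-1 by exact: powR_gt0.
  have /cvgrPdist_le/(_ _ d0) := cg; apply: filterS => s.
  rewrite -gt !sub0r !normrN ger0_norm // ger0_norm ?powR_ge0 // => H.
  have := ge0_ler_powR (ltW p0) _ _ H; rewrite -powRrM mulVf ?lt0r_neq0 // powRr1 ?(ltW e0) //.
  by apply; rewrite nnegrE // ltW.
- apply: (@continuous_comp _ _ _ g (fun x => x `^ p)) => //.
  apply: differentiable_continuous; apply/derivable1_diffP.
  by apply: derivable_powR; rewrite in_itv /= gt.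
Qed.

Lemma unif_cont_itv (g : R -> R) (a b e : R) : continuous g -> 0 < e ->
  exists2 d, 0 < d & forall s t, a <= s <= b -> `|s - t| < d -> `|g s - g t| <= e.
Proof.
move=> cg e0.
have := @segment_compact R a b; rewrite compact_near_coveringP.
move=> /(_ R (0^'+) (fun d s => forall t, `|s - t| < d -> `|g s - g t| <= e) _) => H.
have {}H : \forall d \near 0^'+, `[a, b] `<=` (fun s => forall t, `|s - t| < d -> `|g s - g t| <= e).
  apply: H => x _.
  have e20 : 0 < e / 2 by rewrite divr_gt0.
  have /cvgrPdist_le/(_ _ e20)/nbhs_ballP[d /= d0 Hd] := cg x.
  have d20 : 0 < d / 2 by rewrite divr_gt0.
  exists ([set s | `|x - s| < d / 2], [set r | r < d / 2]) => /=.
    split; first by apply/nbhs_ballP; exists (d / 2).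
    exact: nbhs_right_lt.
  move=> [s r] /= [xs rd] t st.
  have A : `|g x - g s| <= e / 2 by apply: Hd; rewrite /ball /=; lra.
  have B : `|g x - g t| <= e / 2.
    apply: Hd; rewrite /ball /=.
    have := ler_distD s x t; lra.
  have := ler_distD (g x) (g s) (g t); rewrite (distrC (g s) (g x)); lra.
have [d [Hd d0]] := filter_ex (filterI H (nbhs_right_gt 0)).
by exists d => // s t sab; apply: Hd; rewrite /= in_itv.
Qed.

Lemma cis_dist_le (s : R) : normc (cis s - 1) <= 2 * `|s|.
Proof.
apply: (le_trans (normc_le_ReIm _)) => /=.
have H (f df : R -> R) (x y : R) : (forall z : R, is_derive z 1 f (df z)) -> (forall z, `|df z| <= 1) ->
    x <= y -> `|f y - f x| <= `|y - x|.
  move=> Df bdf xy.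
  have [|c _ ->] := @MVT_segment R f df x y xy (fun z _ => Df z).
    apply: continuous_subspaceT => z; apply: differentiable_continuous.
    by apply/derivable1_diffP; have [] := Df z.
  by rewrite normrM ler_piMl.
have H' (f df : R -> R) : (forall z : R, is_derive z 1 f (df z)) -> (forall z, `|df z| <= 1) ->
    `|f s - f 0| <= `|s|.
  move=> Df bdf; have [s0|s0] := leP 0 s.
    by have := H f df 0 s Df bdf s0; rewrite subr0.
  by have := H f df s 0 Df bdf (ltW s0); rewrite distrC sub0r normrN.
have := H' cos (fun z => - sin z) (@is_derive_cos R) (fun z => ltac:(rewrite normrN; exact: sin_max)).
have := H' sin cos (@is_derive_sin R) (@cos_max R).
rewrite sin0 cos0 !subr0; lra.
Qed.

(** The Schwarz kernel, whose real part is the Poisson kernel. *)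
Definition schwarz (w : C) : C := (1 + w) / (1 - w).

Lemma normc_1B_ge (w : C) : 1 - normc w <= normc (1 - w).
Proof. by have := ler_normcB 1 w; rewrite normc1. Qed.

Lemma schwarz_den (w : C) : normc w < 1 -> 1 - w != 0.
Proof. by move=> w1; rewrite -normc_gt0 (lt_le_trans _ (normc_1B_ge w)) // subr_gt0. Qed.

Lemma Re_schwarz (w : C) : normc w < 1 ->
  complex.Re (schwarz w) = (1 - normc w ^+ 2) / normc (1 - w) ^+ 2.
Proof.
move=> w1; have := w1; have := schwarz_den w1.
rewrite -normc_gt0 => /lt0r_neq0 D _.
have : normc (1 - w) ^+ 2 != 0 by rewrite expf_neq0.
rewrite /schwarz !normc_sqr; case: w {w1 D} => a b /= D.
rewrite !sub0r in D *; field.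
by [].
Qed.

Lemma normc_schwarz_le (w : C) (r : R) : normc w <= r -> r < 1 -> normc (schwarz w) <= 2 / (1 - r).
Proof.
move=> wr r1; rewrite /schwarz normcM normcV.
have D := normc_1B_ge w.
have w0 := normc_ge0 w.
rewrite ler_pdivrMr; last lra.
rewrite mulrAC ler_pdivlMr; last lra.
have := le_normcD 1 w; rewrite normc1; nra.
Qed.

Lemma holo_schwarz (a z : C) : normc (a * z) < 1 -> holo (fun z => schwarz (a * z)) z.
Proof.
move=> H; have hl : holo (fun z => a * z) z := holoM (@holo_cst R a z) (@holo_id R z).
have h1 : holo (fun z => 1 + a * z) z := holoD (@holo_cst R 1 z) hl.
have h2 : holo (fun z => 1 + -1 * (a * z)) z := holoD (@holo_cst R 1 z) (holoM (@holo_cst R (-1) z) hl).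
have E : (fun z => 1 + -1 * (a * z)) = (fun z => 1 - a * z) by apply/funext => w; rewrite mulN1r.
rewrite E in h2.
have h3 : holo (fun z => (1 - a * z)^-1) z := @holoV _ (fun z => 1 - a * z) z (schwarz_den H) h2.
exact: (holoM h1 h3).
Qed.

Lemma Rintegral_itv_sum (g : R -> R) (T : nat -> R) (n : nat) : continuous g ->
  (forall j, T j <= T j.+1) ->
  \int[mu]_(x in `[T 0%N, T n]) g x = \sum_(j < n) \int[mu]_(x in `[T j, T j.+1]) g x.
Proof.
move=> cg T1; elim: n => [|n ih].
  by rewrite big_ord0 set_itv1 Rintegral_set1.
rewrite big_ord_recr /= -ih; apply: Rintegral_split => //; last by move=> x _; exact: cg.
by elim: n {ih} => // n ih; exact: le_trans ih (T1 n).
Qed.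

Lemma continuous_cis_comp (F : C -> C) : (forall z, normc z = 1 -> holo F z) ->
  continuous (fun t => normc (F (cis t))).
Proof.
move=> hF t; apply/cvgrPdist_le => e e0.
have [d d0 Hd] := holo_cont_eps (hF (cis t) (normc_cis t)) e0.
have d20 : 0 < d / 2 by rewrite divr_gt0.
apply/nbhs_ballP; exists (d / 2) => //= s; rewrite /ball /= => ts.
have := Hd (cis s - cis t); rewrite [cis t + _]addrC subrK => H.
have {}H : normc (F (cis s) - F (cis t)) <= e.
  apply: H; have -> : cis s - cis t = cis t * (cis (s - t) - 1).
    by rewrite mulrBr mulr1 -cisD [t + _]addrC subrK.
  rewrite normcM normc_cis mul1r; apply: le_lt_trans (cis_dist_le _) _.
  by rewrite distrC; lra.
rewrite ler_norml; apply/andP; split.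
  by have := ler_normcB (F (cis s)) (F (cis t)); lra.
have := ler_normcB (F (cis t)) (F (cis s)).
by rewrite -(normcN (F (cis t) - F (cis s))) opprB; lra.
Qed.

Lemma exists_subdivision_arc (M : nat) (t : R) : 0 <= t <= pi *+ 2 ->
  exists j : 'I_M.+1, pi *+ 2 / M.+1%:R * j%:R <= t <= pi *+ 2 / M.+1%:R * j.+1%:R.
Proof.
have p0 : 0 < pi *+ 2 :> R by rewrite mulrn_wgt0 // pi_gt0.
set w := pi *+ 2 / M.+1%:R.
have w0 : 0 < w by rewrite divr_gt0.
have wM : w * M.+1%:R = pi *+ 2 by rewrite /w mulfVK.
move=> /andP[t0]; rewrite le_eqVlt => /predU1P[->|t2].
  by exists ord_max; rewrite -wM ler_pM2l // ler_nat leqnSn /=.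
have s0 : 0 <= t / w by rewrite divr_ge0 // ltW.
have /andP[A B] := truncn_itv s0.
rewrite ler_pdivlMr // in A; rewrite ltr_pdivrMr // in B.
have jM : (Num.truncn (t / w) < M.+1)%N.
  by rewrite -(ltr_nat R) -(ltr_pM2r w0) (le_lt_trans A) // mulrC wM.
by exists (Ordinal jM) => /=; rewrite mulrC A mulrC ltW.
Qed.

Lemma normc_sub_cis_le (r s : R) : 0 <= r <= 1 ->
  normc (1 - r%:C * cis s) <= (1 - r) + 2 * `|s|.
Proof.
move=> /andP[r0 r1].
have -> : 1 - r%:C * cis s = (1 - r)%:C - r%:C * (cis s - 1).
  by rewrite rmorphB rmorph1; ring.
apply: (le_trans (le_normcD _ _)); rewrite normcN normcM !normc_real.
rewrite (ger0_norm r0) ger0_norm ?subr_ge0 // lerD2l.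
have := cis_dist_le s; have := normc_ge0 (cis s - 1); nra.
Qed.

Lemma Re_sum (I : Type) (r : seq I) (f : I -> C) :
  complex.Re (\sum_(i <- r) f i) = \sum_(i <- r) complex.Re (f i).
Proof. by elim/big_rec2: _ => // i a z _ <-; case: (f i); case: z. Qed.

Lemma normc_sum (I : Type) (r : seq I) (f : I -> C) :
  normc (\sum_(i <- r) f i) <= \sum_(i <- r) normc (f i).
Proof.
elim/big_rec2: _ => [|i a z _ H]; first by rewrite normc0.
by apply: (le_trans (le_normcD _ _)); rewrite lerD2l.
Qed.

Lemma holo_sum (I : Type) (r : seq I) (f : I -> C -> C) z :
  (forall i, holo (f i) z) -> holo (fun w => \sum_(i <- r) f i w) z.
Proof.
move=> H; elim: r => [|i r ih].
  by under eq_fun do rewrite big_nil; exact: (@holo_cst R 0 z).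
by under eq_fun do rewrite big_cons; exact: (holoD (H i) ih).
Qed.

Lemma ReZ (a : R) (z : C) : complex.Re (a%:C * z) = a * complex.Re z.
Proof. by case: z => x y /=; rewrite mul0r subr0. Qed.

(** The numbers [e j] are the conjugates of points of the circle: the kernels have
    their poles just outside the disc, on the rays through these points. *)
Lemma schwarz_sum_bound (n : nat) (c : 'I_n -> R) (e : 'I_n -> C) (r l : R) (z : C) :
  (forall j, 0 <= c j) -> (forall j, normc (e j) = 1) -> 0 <= r -> r < 1 -> normc z <= l -> l <= 1 ->
  normc (\sum_(j < n) (c j)%:C * schwarz (r%:C * (e j) * z)) <= (\sum_(j < n) c j) * (2 / (1 - r * l)).
Proof.
move=> c0 e1 r0 r1 zl l1; apply: (le_trans (normc_sum _ _)).
rewrite mulr_suml; apply: ler_sum => j _.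
rewrite normcM normc_real ger0_norm //; apply: ler_wpM2l => //.
have l0 : 0 <= l := le_trans (normc_ge0 z) zl.
apply: normc_schwarz_le; last by nra.
by rewrite !normcM e1 mulr1 normc_real ger0_norm // ler_wpM2l.
Qed.

Lemma Re_schwarz_gt0 (w : C) : normc w < 1 -> 0 < complex.Re (schwarz w).
Proof.
move=> w1; rewrite Re_schwarz // divr_gt0 //.
  by rewrite subr_gt0 expr_lt1 ?normc_ge0.
by rewrite exprn_gt0 // normc_gt0 schwarz_den.
Qed.

Lemma Re_schwarz_lb (w : C) : normc w < 1 ->
  (1 - normc w) / 4 <= complex.Re (schwarz w).
Proof.
move=> w1; rewrite Re_schwarz //; have w0 := normc_ge0 w.
rewrite ler_pdivlMr; last by rewrite exprn_gt0 // normc_gt0 schwarz_den.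
have A : normc (1 - w) ^+ 2 <= 4.
  have := le_normcD 1 (- w); rewrite normcN normc1; have := normc_ge0 (1 - w); nra.
have : (1 - normc w) / 4 * normc (1 - w) ^+ 2 <= (1 - normc w) / 4 * 4.
  by rewrite ler_wpM2l //; lra.
nra.
Qed.

(** At depth [h] below the circle the Poisson kernel is of the order of 1/h as
    long as the distance to the pole is of the order of [h]; 289 is the square of
    17. *)
Lemma Re_schwarz_near (w : C) (h : R) : 0 < h -> h <= 1 -> normc w = 1 - h ->
  normc (1 - w) <= 17 * h -> (289 * h)^-1 <= complex.Re (schwarz w).
Proof.
move=> h0 h1 wh H; have w1 : normc w < 1 by lra.
rewrite Re_schwarz // wh ler_pdivlMr; last by rewrite exprn_gt0 // normc_gt0 schwarz_den.
rewrite ler_pdivrMl; last by apply: mulr_gt0; [rewrite ltr0n|exact: h0].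
have n0 := normc_ge0 (1 - w); nra.
Qed.

(** The circle is cut into M arcs so short that |F|^p varies by at most [e] on
    each of them, and [v j] is the mean of |F|^p over the j-th arc, plus [e]; thus
    |F|^p <= v j there.  The kernel with pole at distance about 1/M from the
    beginning of the arc has a real part of at least M/289 on the whole arc, and
    the other kernels have positive real part.  So the sum of the kernels with
    coefficients (289/M) v j is a majorant Phi as in [holo_power_majorant], and
    the sum of its coefficients is 289 times the circular mean plus [e]. *)
Lemma circle_majorant (F : C -> C) (p e : R) (b : C) : 0 < p -> 0 < e ->
  (forall z, normc z <= 1 -> holo F z) -> normc b < 1 ->
  normc (F b) `^ p <= 578 / (1 - normc b) *
    ((pi *+ 2)^-1 * \int[mu]_(t in `[0, pi *+ 2]) (normc (F (cis t)) `^ p) + e).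
Proof.
move=> p0 e0 hF b1.
pose g t := normc (F (cis t)) `^ p.
have g0 t : 0 <= g t by exact: powR_ge0.
have cg : continuous g.
  move=> t; apply: powR_cont => //; first by move=> s; exact: normc_ge0.
  by apply: continuous_cis_comp => z z1; apply: hF; rewrite z1.
have tau0 : 0 < pi *+ 2 :> R by rewrite mulrn_wgt0 // pi_gt0.
have [d d0 Hd] := unif_cont_itv 0 (pi *+ 2) cg e0.
pose m := Num.truncn ((pi *+ 2) / d); pose w : R := pi *+ 2 / m.+1%:R.
have M0 : 0 < m.+1%:R :> R by rewrite ltr0n.
have w0 : 0 < w by rewrite divr_gt0.
have wd : w < d.
  by rewrite ltr_pdivrMr // mulrC -ltr_pdivrMr //; exact: truncnS_gt.
pose T (j : nat) := w * j%:R.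
have TS j : T j.+1 = T j + w by rewrite /T -natr1 mulrDr mulr1.
pose v (j : nat) : R := w^-1 * (\int[mu]_(t in `[T j, T j.+1]) g t) + e.
have T0 j : 0 <= T j by rewrite mulr_ge0 // ltW.
have TM j : (j < m.+1)%N -> T j.+1 <= pi *+ 2.
  move=> jm; rewrite /T /w mulrAC ler_pdivrMr // ler_pM2l // ler_nat //.
have Tle j : T j <= T j.+1 by rewrite TS lerDl ltW.
have cgi a c : cont_on a c g by move=> x _; exact: cg.
have ve j : e <= v j.
  by rewrite /v lerDr mulr_ge0 ?invr_ge0 ?(ltW w0) // Rintegral_ge0.
have gv j t : (j < m.+1)%N -> T j <= t <= T j.+1 -> g t <= v j.
  move=> jm tj; rewrite /v -lerBlDr ler_pdivlMl //.
  have -> : w * (g t - e) = (g t - e) * (T j.+1 - T j) by rewrite TS [T j + w]addrC addrK mulrC.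
  rewrite -Rintegral_itv_cst //; apply: le_Rintegral_itv => //; first exact: cont_on_cst.
  move=> x xj; have := Hd t x; have := TM j jm; have := TS j; have := T0 j => A1 A2 A3 H.
  have {}H : `|g t - g x| <= e.
    apply: H; first by case/andP: tj => ? ?; apply/andP; split; lra.
    apply: le_lt_trans wd; rewrite ler_norml; case/andP: tj; case/andP: xj; lra.
  by move: H; rewrite ler_norml; lra.
pose rho : R := 1 - m.+1%:R^-1.
have iM0 : 0 < m.+1%:R^-1 :> R by rewrite invr_gt0.
have iM1 : m.+1%:R^-1 <= 1 :> R by rewrite invf_le1 // ler1n.
have rho0 : 0 <= rho by rewrite subr_ge0.
have rho1 : rho < 1 by rewrite ltrBlDr ltrDl.
pose c (j : 'I_m.+1) : R := 289 / m.+1%:R * v j.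
pose E (j : 'I_m.+1) : C := cis (- T j).
have c0 j : 0 < c j.
  apply: mulr_gt0; last exact: lt_le_trans e0 (ve j).
  by apply: divr_gt0; rewrite ?ltr0n.
have c0' j : 0 <= c j by rewrite ltW.
have E1 j : normc (E j) = 1 by exact: normc_cis.
pose Phi z := \sum_(j < m.+1) (c j)%:C * schwarz (rho%:C * (E j) * z).
have nw j z : normc (rho%:C * E j * z) = rho * normc z.
  by rewrite !normcM E1 mulr1 normc_real ger0_norm.
have nw1 j z : normc z <= 1 -> normc (rho%:C * E j * z) < 1.
  by move=> z1; rewrite nw (le_lt_trans _ rho1) // ler_piMr.
have RePhi z : complex.Re (Phi z) = \sum_(j < m.+1) c j * complex.Re (schwarz (rho%:C * (E j) * z)).
  by rewrite /Phi Re_sum; apply: eq_bigr => j _; rewrite ReZ.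
have Phi_term j z : normc z <= 1 -> c j * complex.Re (schwarz (rho%:C * (E j) * z)) <= normc (Phi z).
  move=> z1; apply: le_trans (le_trans (ler_norm _) (Re_le_normc _)).
  rewrite RePhi (bigD1 j) //= lerDl sumr_ge0 // => i _.
  by rewrite mulr_ge0 // ltW // Re_schwarz_gt0 // nw1.
have Phib : normc (Phi b) <= 578 / (1 - normc b) * ((pi *+ 2)^-1 * \int[mu]_(t in `[0, pi *+ 2]) g t + e).
  have -> : (pi *+ 2)^-1 * \int[mu]_(t in `[0, pi *+ 2]) g t + e = m.+1%:R^-1 * \sum_(j < m.+1) v j.
    have -> : pi *+ 2 = T m.+1 by rewrite /T /w divfK ?lt0r_neq0.
    have {1}-> : 0 = T 0%N by rewrite /T mulr0.
    rewrite (Rintegral_itv_sum m.+1 cg Tle) /v big_split /= sumr_const card_ord -mulr_sumr mulrDr.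
    congr (_ + _); last by rewrite -[e *+ _]mulr_natl mulKf ?lt0r_neq0.
    by rewrite mulrA /T invfM [_^-1 * w^-1]mulrC.
  apply: (le_trans (schwarz_sum_bound c0' E1 rho0 rho1 (lexx _) (ltW b1))).
  rewrite /c -mulr_sumr.
  have V0 : 0 <= \sum_(j < m.+1) v j by apply: sumr_ge0 => j _; exact: le_trans (ltW e0) (ve j).
  set V := \sum_(j < m.+1) v j in V0 *.
  have -> : 578 / (1 - normc b) * (m.+1%:R^-1 * V) = 289 / m.+1%:R * V * (2 / (1 - normc b)).
    by field; rewrite lt0r_neq0 ?subr_gt0 //= lt0r_neq0.
  apply: ler_wpM2l; first by apply: mulr_ge0; [apply: divr_ge0; exact: ler0n|exact: V0].
  rewrite ler_pM2l // lef_pV2 ?posrE; [|by have := normc_ge0 b; nra|lra].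
  by have := normc_ge0 b; nra.
apply: le_trans Phib.
pose l := c ord0 * ((1 - rho) / 4).
apply: (@holo_power_majorant F Phi p l ((\sum_(j < m.+1) c j) * (2 / (1 - rho * 1)))) => //.
- by rewrite /l mulr_gt0 // divr_gt0 // subr_gt0.
- move=> z z1; split; first exact: hF.
  split.
    apply: holo_sum => j; apply: (@holoM _ (fun=> (c j)%:C)); first exact: holo_cst.
    by apply: holo_schwarz; exact: nw1.
  apply/andP; split; last exact: schwarz_sum_bound.
  apply: le_trans (Phi_term ord0 z z1); rewrite ler_pM2l //.
  apply: le_trans (Re_schwarz_lb (nw1 _ _ z1)).
  by rewrite nw ler_pM2r ?invr_gt0 // lerD2l lerN2 ler_piMr.
- move=> z z1; have [t t2 ->] := cis_surj z1.
  have [j tj] := exists_subdivision_arc m t2.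
  have gj : g t <= v j by apply: gv => //; case: j {tj}.
  apply: (le_trans gj).
  have := Phi_term j (cis t); rewrite normc_cis => /(_ (lexx _)); apply: le_trans.
  have -> : rho%:C * E j * cis t = rho%:C * cis (t - T j).
    by rewrite -mulrA -cisD addrC.
  have H := @Re_schwarz_near (rho%:C * cis (t - T j)) (m.+1%:R^-1) iM0 iM1.
  have {}H : (289 * m.+1%:R^-1)^-1 <= complex.Re (schwarz (rho%:C * cis (t - T j))).
    apply: H; first by rewrite normcM normc_cis mulr1 normc_real ger0_norm.
    apply: le_trans (normc_sub_cis_le _ _) _; first by rewrite rho0 ltW.
    have A : `|t - T j| <= w by move: tj; rewrite -/w -/(T j) -/(T j.+1) TS ler_norml; lra.
    have B : w <= 8 * m.+1%:R^-1.
      by rewrite ler_pM2r // mulr2n; have := @pihalf_lt2 R; lra.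
    have {A B} := le_trans A B.
    rewrite (_ : 1 - rho = m.+1%:R^-1); last by rewrite /rho opprB addrC subrK.
    move: (m.+1%:R^-1) `|t - T j| => x y; lra.
  apply: le_trans (ler_wpM2l (c0' j) H).
  rewrite /c mulrAC mulfV; first by rewrite mul1r.
  by apply: lt0r_neq0; apply: mulr_gt0; rewrite ?ltr0n.
Qed.

(** The case e -> 0 of the preceding lemma. *)
Lemma circle_bound (F : C -> C) (p : R) (b : C) : 0 < p ->
  (forall z, normc z <= 1 -> holo F z) -> normc b < 1 ->
  normc (F b) `^ p <= 578 / (1 - normc b) *
    ((pi *+ 2)^-1 * \int[mu]_(t in `[0, pi *+ 2]) (normc (F (cis t)) `^ p)).
Proof.
move=> p0 hF b1; have H e (e0 : 0 < e) := circle_majorant p0 e0 hF b1.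
have K0 : 0 < 578 / (1 - normc b) by apply: divr_gt0; rewrite ?subr_gt0 ?ltr0n.
move: (_^-1 * _) (578 / _) K0 H => A K K0 H.
apply/ler_addgt0Pr => e e0; apply: (le_trans (H _ (divr_gt0 e0 K0))).
by rewrite mulrDr mulrCA divff ?mulr1 // lt0r_neq0.
Qed.
End growth.

(** * Rotation invariance of planar Lebesgue measure *)

Section plane_measure.
Variable R : realType.
Local Notation C := R[i].
Local Notation mu := (@lebesgue_measure R).
Local Notation mu2 := (@lebesgue_measure R \x @lebesgue_measure R)%E.
Local Open Scope ereal_scope.

Lemma lebesgue_measure_preimage_add (c : R) (A : set (measurableTypeR R)) : measurable A ->
  mu ((fun x => (x + c)%R) @^-1` A) = mu A.
Proof.
move=> mA.
have mf : measurable_fun [set: measurableTypeR R] (fun x : measurableTypeR R => (x + c)%R : measurableTypeR R).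
  exact: measurable_funD.
pose mf' := HB.pack_for {mfun (measurableTypeR R) >-> (measurableTypeR R)}
  (fun x : measurableTypeR R => (x + c)%R : measurableTypeR R) (isMeasurableFun.Build _ _ _ _ _ mf).
have := @lebesgue_measure_unique R (pushforward mu mf').
move=> /(_ mf) H; symmetry; apply: H => // X [[a b] _ <-] /=.
rewrite /pushforward /=.
have -> : (fun x => (x + c)%R) @^-1` `]a, b] = `](a - c)%R, (b - c)%R]%classic.
  by apply/seteqP; split => x /=; rewrite !in_itv /= ltrBlDr lerBrDr.
rewrite !lebesgue_measure_itv /= !lte_fin ltrD2r.
by case: ifP => // _; rewrite -!EFinB; congr EFin; ring.
Qed.

Lemma ge0_integral_translate (c : R) (f : measurableTypeR R -> \bar R) :
  measurable_fun setT f -> (forall x, 0 <= f x) ->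
  \int[mu]_x f (x + c)%R = \int[mu]_x f x.
Proof.
move=> mf f0.
have mt : measurable_fun [set: measurableTypeR R] (fun x : measurableTypeR R => (x + c)%R : measurableTypeR R).
  exact: measurable_funD.
have := @ge0_integral_pushforward _ _ _ _ R _ mt mu setT f measurableT mf (fun x _ => f0 x).
rewrite preimage_setT => <-.
apply: eq_measure_integral => A mA _.
exact: (lebesgue_measure_preimage_add c mA).
Qed.

(** By Tonelli's theorem, since on each horizontal line a shear is a
    translation. *)
Lemma ge0_integral_shear1 (k : R) (F : R2 R -> \bar R) :
  measurable_fun setT F -> (forall w, 0 <= F w) ->
  \int[mu2]_w F ((w.1 + k * w.2)%R, w.2) = \int[mu2]_w F w.
Proof.
move=> mF F0.
have mFs : measurable_fun setT (fun w : R2 R => F ((w.1 + k * w.2)%R, w.2)).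
  apply: (measurableT_comp mF); apply: measurable_fun_pair => //.
  by apply: measurable_funD => //; apply: measurable_funM.
rewrite (fubini_tonelli2 F mF F0) (fubini_tonelli2 _ mFs (fun w => F0 _)).
apply: eq_integral => y _; rewrite /fubini_G /=.
apply: (@ge0_integral_translate (k * y)%R (fun x => F (x, y))) => //.
exact: measurableT_comp.
Qed.

Lemma ge0_integral_shear2 (k : R) (F : R2 R -> \bar R) :
  measurable_fun setT F -> (forall w, 0 <= F w) ->
  \int[mu2]_w F (w.1, (w.2 + k * w.1)%R) = \int[mu2]_w F w.
Proof.
move=> mF F0.
have mFs : measurable_fun setT (fun w : R2 R => F (w.1, (w.2 + k * w.1)%R)).
  apply: (measurableT_comp mF); apply: measurable_fun_pair => //.
  by apply: measurable_funD => //; apply: measurable_funM.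
rewrite (fubini_tonelli1 F mF F0) (fubini_tonelli1 _ mFs (fun w => F0 _)).
apply: eq_integral => x _; rewrite /fubini_F /=.
apply: (@ge0_integral_translate (k * x)%R (fun y => F (x, y))) => //.
exact: measurableT_comp.
Qed.

Definition rot (t : R) (w : R2 R) : R2 R :=
  ((cos t * w.1 - sin t * w.2)%R, (sin t * w.1 + cos t * w.2)%R).

Lemma cplx_rot t w : cplx (rot t w) = (cis t * cplx w)%R.
Proof. by rewrite /rot /cplx /cis /=; congr Complex; rewrite addrC. Qed.

Lemma measurable_rot t : measurable_fun setT (rot t).
Proof.
apply: measurable_fun_pair; [apply: measurable_funB|apply: measurable_funD]; exact: measurable_funM.
Qed.

(** The rotation by 2s is the product of the shears with slopes - tan s, sin 2s
    and - tan s. *)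
Lemma ge0_integral_rot2 (s : R) (F : R2 R -> \bar R) : cos s != 0%R ->
  measurable_fun setT F -> (forall w, 0 <= F w) ->
  \int[mu2]_w F (rot (s *+ 2) w) = \int[mu2]_w F w.
Proof.
move=> cs mF F0.
pose k : R := tan s.
pose sh1 (w : R2 R) : R2 R := ((w.1 + - k * w.2)%R, w.2).
pose sh2 (w : R2 R) : R2 R := (w.1, (w.2 + sin (s *+ 2) * w.1)%R).
have msh1 : measurable_fun setT sh1.
  apply: measurable_fun_pair => //.
  by apply: measurable_funD => //; apply: measurable_funM.
have msh2 : measurable_fun setT sh2.
  apply: measurable_fun_pair => //.
  by apply: measurable_funD => //; apply: measurable_funM.
rewrite -(ge0_integral_shear1 (- k) mF F0).
have m1 : measurable_fun setT (F \o sh1) by exact: measurableT_comp.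
rewrite -(@ge0_integral_shear2 (sin (s *+ 2)) (F \o sh1) _ (fun w => F0 _)) //.
have m2 : measurable_fun setT (F \o sh1 \o sh2) by exact: measurableT_comp.
rewrite -(@ge0_integral_shear1 (- k) (F \o sh1 \o sh2) _ (fun w => F0 _)) //.
apply: eq_integral => -[x y] _ /=; congr F.
have c2 : (cos s ^+ 2 = 1 - sin s ^+ 2)%R by rewrite sin2cos2; ring.
have E1 : (1 - sin (s *+ 2) * k = cos (s *+ 2))%R.
  rewrite /k /tan sin_mulr2n cos_mulr2n c2.
  rewrite (_ : (cos s * sin s) *+ 2 * (sin s / cos s) = (sin s ^+ 2) *+ 2 :> R)%R; last by field.
  ring.
have E2 : (k + cos (s *+ 2) * k = sin (s *+ 2))%R.
  rewrite /k /tan sin_mulr2n cos_mulr2n.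
  rewrite (_ : sin s / cos s + ((cos s ^+ 2) *+ 2 - 1) * (sin s / cos s) = (cos s * sin s) *+ 2 :> R)%R //.
  by field.
rewrite /sh1 /sh2 /rot /=; congr pair.
- have E3 : (k + (1 - sin (s *+ 2) * k) * k - sin (s *+ 2) = 0)%R by rewrite E1 E2 subrr.
  apply/eqP; rewrite -subr_eq0 -E1; apply/eqP.
  by rewrite -[RHS](mul0r (y : R)) -E3; ring.
- rewrite -E1; ring.
Qed.

Lemma rotD s t w : rot (s + t) w = rot s (rot t w).
Proof. by rewrite /rot cosD sinD /=; congr pair; ring. Qed.

(** Where tan (t/2) is infinite, the rotation is done in two steps of t/2. *)
Lemma ge0_integral_rot (t : R) (F : R2 R -> \bar R) :
  measurable_fun setT F -> (forall w, 0 <= F w) ->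
  \int[mu2]_w F (rot t w) = \int[mu2]_w F w.
Proof.
move=> mF F0.
(* If cos (t/2) vanishes, then cos (t/4) does not. *)
have h2 (x : R) : x = ((x / 2) *+ 2)%R by rewrite -mulr_natr divfK.
have [c0|c0] := eqVneq (cos (t / 2)) 0%R; last by rewrite {1}(h2 t) ge0_integral_rot2.
have c4 : cos (t / 2 / 2) != 0%R.
  apply/eqP => c4; move: c0; rewrite {1}(h2 (t / 2)%R) cos_mulr2n c4 expr0n mul0rn sub0r => /eqP.
  by rewrite oppr_eq0 oner_eq0.
have E w : rot t w = rot (t / 2) (rot (t / 2) w) by rewrite -rotD -mulr2n -h2.
under eq_integral do rewrite E.
have mFr : measurable_fun setT (F \o rot (t / 2)) by apply: measurableT_comp => //; exact: measurable_rot.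
have := @ge0_integral_rot2 (t / 2 / 2) (F \o rot (t / 2)) c4 mFr (fun w => F0 _).
by rewrite -h2 /= => ->; rewrite {1}(h2 (t / 2)%R) ge0_integral_rot2.
Qed.

(** Open squares stand for the topology of the plane: the rational ones are
    countable, so a union of open squares is measurable. *)
Definition box (w : R2 R) (d : R) : set (R2 R) := `](w.1 - d)%R, (w.1 + d)%R[ `*` `](w.2 - d)%R, (w.2 + d)%R[.

Lemma box_measurable (U : set (R2 R)) :
  (forall w, U w -> exists2 d : R, (0 < d)%R & box w d `<=` U) -> measurable U.
Proof.
move=> HU.
pose B (q : (rat * rat) * rat) : set (R2 R) := box (ratr q.1.1, ratr q.1.2) (ratr q.2).
pose P := [set q | B q `<=` U].
have -> : U = \bigcup_(q in P) B q.
  apply/seteqP; split; last by move=> w [q Pq /Pq].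
  move=> w Uw; have [d d0 dU] := HU w Uw.
  have d40 : (0 < d / 4)%R by rewrite divr_gt0.
  have [a] := @rat_in_itvoo R (w.1 - d / 4) (w.1 + d / 4) ltac:(lra).
  have [b] := @rat_in_itvoo R (w.2 - d / 4) (w.2 + d / 4) ltac:(lra).
  have [c] := @rat_in_itvoo R (d / 4) (d / 2) ltac:(lra).
  rewrite !in_itv /= => /andP[c1 c2] /andP[b1 b2] /andP[a1 a2].
  exists ((a, b), c).
    move=> z; rewrite /B /box /= !in_itv /= => -[/andP[z1 z2] /andP[z3 z4]].
    by apply: dU; rewrite /box /= !in_itv /=; split; apply/andP; split; lra.
  by rewrite /B /box /= !in_itv /=; split; apply/andP; split; lra.
rewrite bigcup_mkcond; apply: countable_bigcupT_measurable => [|q]; first exact: countableP.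
case: ifP => // _; apply: measurableX; exact: measurable_itv.
Qed.

Lemma box_measurable_fun (D : set (R2 R)) (h : R2 R -> R) :
  (forall w c, D w -> (c < h w)%R -> exists2 d : R, (0 < d)%R &
     forall z, box w d z -> D z /\ (c < h z)%R) ->
  measurable_fun D h.
Proof.
move=> H mD; apply: (measurability _ (RGenOInfty.measurableE R)) => //.
move=> _ [_ [c ->] <-]; apply: box_measurable => w [Dw /=].
rewrite in_itv /= andbT => cw; have [d d0 Hd] := H w c Dw cw.
exists d => // z /Hd[Dz cz]; split => //=.
by rewrite in_itv /= andbT.
Qed.

End plane_measure.

(** * Point evaluation on weighted Bergman spaces *)

Section point_evaluation.
Variable R : realType.
Local Notation C := R[i].
Local Notation mu := (@lebesgue_measure R).
Local Notation mu2 := (@lebesgue_measure R \x @lebesgue_measure R)%E.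
Local Open Scope ereal_scope.

Lemma unit_discE (z : C) : unit_disc R z <-> (normc z < 1)%R.
Proof. by rewrite /unit_disc /disc /= subr0. Qed.

(** [circle_bound] for F(w) = f(wz) at the point a/z. *)
Lemma circle_mean_bound (f : C -> C) (p : R) (a z : C) : (0 < p)%R ->
  analytic_in_disc f -> (normc a < normc z)%R -> (normc z < 1)%R ->
  (normc (f a) `^ p <= 578 / (1 - normc a / normc z) *
    ((pi *+ 2)^-1 * (\int[mu]_(t in `[0, pi *+ 2]) (normc (f (cis t * z)) `^ p))))%R.
Proof.
move=> p0 hf az z1.
have z0 : (0 < normc z)%R := le_lt_trans (normc_ge0 a) az.
have zn0 : z != 0%R by rewrite -normc_gt0.
have hF : forall w, (normc w <= 1)%R -> holo (fun w => f (w * z))%R w.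
  move=> w w1; apply: (@holo_comp _ f (fun w => w * z)%R).
    by apply: (@holoM _ id (fun=> z)); [exact: holo_id|exact: holo_cst].
  apply: hf; apply/unit_discE; rewrite normcM.
  by apply: le_lt_trans z1; apply: ler_piMl => //; exact: ltW.
have := @circle_bound R (fun w => f (w * z))%R p (a / z)%R p0 hF.
rewrite normcM normcV ltr_pdivrMr // mul1r az => /(_ isT).
by rewrite divfK.
Qed.

Lemma continuous_circle (f : C -> C) (p : R) (z : C) : (0 < p)%R ->
  analytic_in_disc f -> (normc z < 1)%R ->
  continuous (fun t => normc (f (cis t * z)) `^ p)%R.
Proof.
move=> p0 hf z1 t; apply: powR_cont => //; first by move=> s; exact: normc_ge0.
apply: (@continuous_cis_comp _ (fun w => f (w * z))%R) => w w1.
apply: (@holo_comp _ f (fun w => w * z)%R).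
  by apply: (@holoM _ id (fun=> z)); [exact: holo_id|exact: holo_cst].
by apply: hf; apply/unit_discE; rewrite normcM w1 mul1r.
Qed.

Lemma normc_cplxB (w z : R2 R) (d : R) : box w d z -> (normc (cplx z - cplx w) < d + d)%R.
Proof.
move=> bz; apply: (le_lt_trans (normc_le_ReIm _)); move: bz.
rewrite /box /= !in_itv /= => -[/andP[a b] /andP[c e]].
by apply: ltrD; rewrite ltr_norml; lra.
Qed.

Lemma measurable_normc_cplx : measurable_fun setT (fun w : R2 R => normc (cplx w)).
Proof.
apply: box_measurable_fun => w c _ cw; exists ((normc (cplx w) - c) / 2)%R.
  by rewrite divr_gt0 // subr_gt0.
move=> z /normc_cplxB H; split => //.
have := ler_normcB (cplx w) (cplx z); rewrite -(normcN (cplx w - cplx z)%R) opprB; lra.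
Qed.

Lemma measurable_normc_lt (a b : R) : measurable (plane [set z : C | (a < normc z < b)%R]).
Proof.
have := measurable_normc_cplx measurableT (measurable_itv `]a, b[).
by rewrite setTI.
Qed.

Lemma measurable_unit_disc : measurable (plane (unit_disc R)).
Proof.
have -> : unit_disc R = [set z : C | (- 1 < normc z < 1)%R].
  apply/seteqP; split => z; rewrite unit_discE /=.
    by move=> ->; rewrite andbT (lt_le_trans _ (normc_ge0 z)).
  by case/andP.
exact: measurable_normc_lt.
Qed.

Lemma measurable_holo (f : C -> C) : analytic_in_disc f ->
  measurable_fun (plane (unit_disc R)) (fun w => normc (f (cplx w))).
Proof.
move=> hf; apply: box_measurable_fun => w c Dw cw.
have w1 : (normc (cplx w) < 1)%R by apply/unit_discE.
have e0 : (0 < (normc (f (cplx w)) - c) / 2)%R by rewrite divr_gt0 // subr_gt0.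
have [d d0 Hd] := holo_cont_eps (hf _ Dw) e0.
exists (Num.min (d / 2) ((1 - normc (cplx w)) / 2))%R.
  by rewrite lt_min !divr_gt0 // subr_gt0.
move=> z /normc_cplxB.
set m := Num.min _ _ => H.
have m1 : (m <= d / 2)%R by rewrite ge_min lexx.
have m2 : (m <= (1 - normc (cplx w)) / 2)%R by rewrite ge_min lexx orbT.
split.
  apply/unit_discE.
  have := le_normcD (cplx z - cplx w)%R (cplx w); rewrite subrK; lra.
have := Hd (cplx z - cplx w)%R; rewrite [(cplx w + _)%R]addrC subrK => Hz.
have {}Hz := Hz ltac:(lra).
have := ler_normcB (f (cplx w)) (f (cplx z)); rewrite -(normcN (f (cplx w) - f (cplx z))%R) opprB; lra.
Qed.

Lemma radial_cis (omega : C -> R) (t : R) (z : C) : radial omega -> (normc z < 1)%R ->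
  omega (cis t * z)%R = omega z.
Proof.
move=> ro z1; rewrite ro; last by apply/unit_discE; rewrite normcM normc_cis mul1r.
by rewrite [RHS]ro ?normcM ?normc_cis ?mul1r //; apply/unit_discE.
Qed.

Definition annulus (a : R) : set C := [set z | (a < normc z < 1)%R].

Lemma annulus_disc (a : R) : plane (annulus a) `<=` plane (unit_disc R).
Proof. by move=> w; rewrite /plane /= unit_discE => /andP[]. Qed.

Lemma sigma_finite_plane : sigma_finite setT mu2.
Proof.
have /sigma_finiteP[F [TF ndF Foo]] := sigma_finiteT mu.
exists (fun n => F n `*` F n).
  apply/seteqP; split => // -[x y] _.
  have : setT x by []. rewrite TF => -[n _ Fx].
  have : setT y by []. rewrite TF => -[m _ Fy].
  exists (maxn n m) => //; split.
    by move: x Fx; apply/subsetPset/ndF/leq_maxl.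
  by move: y Fy; apply/subsetPset/ndF/leq_maxr.
move=> k; have [mF Fk] := Foo k; split; first exact: measurableX.
by rewrite product_measure1E // lte_mul_pinfty // ge0_fin_numE.
Qed.

(** Tonelli's theorem is applied below with the plane as one of the factors, and
    asks for this structure. *)
Definition plane_lebesgue : {sigma_finite_measure set (R2 R) -> \bar R} :=
  HB.pack_for {sigma_finite_measure set (R2 R) -> \bar R} mu2
    (Measure_isSigmaFinite.Build _ _ _ mu2 sigma_finite_plane).

(** Tonelli's theorem in the point and the angle, and rotation invariance for each
    fixed angle. *)
Lemma ge0_integral_rotation_mean (H : R2 R -> \bar R) :
  measurable_fun setT H -> (forall w, 0 <= H w) ->
  measurable_fun setT (fun w => \int[mu]_(t in `[0%R, (pi *+ 2)%R]) H (rot t w)) /\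
  \int[mu2]_w (\int[mu]_(t in `[0%R, (pi *+ 2)%R]) H (rot t w)) = (pi *+ 2)%:E * \int[mu2]_w H w.
Proof.
move=> mH H0.
pose I : set (measurableTypeR R) := `[0%R, (pi *+ 2)%R]%classic.
pose Phi (x : R2 R * measurableTypeR R) := (\1_I x.2)%:E * H (rot x.2 x.1).
have mrot : measurable_fun setT (fun x : R2 R * measurableTypeR R => rot x.2 x.1).
  have m1 : measurable_fun setT (fun x : R2 R * measurableTypeR R => (x.1.1 : R)).
    exact: (measurableT_comp measurable_fst measurable_fst).
  have m2 : measurable_fun setT (fun x : R2 R * measurableTypeR R => (x.1.2 : R)).
    exact: (measurableT_comp measurable_snd measurable_fst).
  have mc : measurable_fun setT (fun x : R2 R * measurableTypeR R => cos (x.2 : R)).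
    apply: (@measurableT_comp _ _ _ _ _ _ (@cos R)) => //.
    by apply: continuous_measurable_fun; exact: continuous_cos.
  have ms : measurable_fun setT (fun x : R2 R * measurableTypeR R => sin (x.2 : R)).
    apply: (@measurableT_comp _ _ _ _ _ _ (@sin R)) => //.
    by apply: continuous_measurable_fun; exact: continuous_sin.
  apply: measurable_fun_pair; [apply: measurable_funB|apply: measurable_funD]; exact: measurable_funM.
have mI : measurable_fun setT (fun x : R2 R * measurableTypeR R => \1_I x.2 : R).
  apply: (@measurableT_comp _ _ _ _ _ _ (\1_I : measurableTypeR R -> R) _ snd) => //.
  by apply: measurable_indic; exact: measurable_itv.
have mPhi : measurable_fun setT Phi.
  apply: emeasurable_funM; last exact: (measurableT_comp mH mrot).
  exact/measurable_EFinP.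
have Phi0 x : 0 <= Phi x by rewrite /Phi mule_ge0 // lee_fin.
have E w : \int[mu]_(t in `[0%R, (pi *+ 2)%R]) H (rot t w) = \int[mu]_t Phi (w, t).
  rewrite integral_mkcond; apply: eq_integral => t _.
  rewrite patchE /Phi /= indicE; case: ifP => _; by rewrite ?mul1e ?mul0e.
split.
  under eq_fun do rewrite E.
  exact: (measurable_fun_fubini_tonelli_F Phi).
under eq_integral do rewrite E.
have FT := @fubini_tonelli _ _ _ _ R plane_lebesgue mu Phi mPhi Phi0.
etransitivity; first exact FT.
transitivity (\int[mu]_t ((\1_I t)%:E * \int[mu2]_w H w)).
  apply: eq_integral => t _; rewrite /Phi /=.
  have mHr : measurable_fun setT (fun w => H (rot t w)) := measurableT_comp mH (@measurable_rot R t).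
  by rewrite ge0_integralZl_EFin ?ge0_integral_rot.
have mI' : measurable I by exact: measurable_itv.
have mEI : measurable_fun setT (fun t : measurableTypeR R => (\1_I t)%:E : \bar R).
  by apply/measurable_EFinP; exact: measurable_indic.
rewrite ge0_integralZr //; last by apply: integral_ge0.
rewrite integral_indic // setIT; congr (_ * _).
have := @lebesgue_measure_itv R `[0%R, (pi *+ 2)%R].
by rewrite /= lte_fin mulrn_wgt0 ?pi_gt0 // sube0.
Qed.

(** The bound by circular means is multiplied by omega(z) and integrated over the
    annulus, where 1 - r/|z| >= (1-r)/2.  As omega is radial, it may be put under
    the circular mean, and [ge0_integral_rotation_mean] removes the mean. *)
Lemma point_evaluation (f : C -> C) (p r : R) (omega : C -> R) :
  (0 < p)%R -> (0 < r < 1)%R -> weight omega -> radial omega -> analytic_in_disc f ->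
  (normc (f r%:C) `^ p)%:E * weight_mass omega (annulus ((1 + r) / 2)) <=
  (1156 / (1 - r))%:E * \int[@dA R]_(w in plane (unit_disc R))
     (normc (f (cplx w)) `^ p * omega (cplx w))%:E.
Proof.
move=> p0 /andP[r0 r1] [om0 iom] rom hf.
set rho := ((1 + r) / 2)%R.
set A := plane (annulus rho).
have mA : measurable A by exact: measurable_normc_lt.
have AD : A `<=` plane (unit_disc R) := @annulus_disc rho.
have mD := measurable_unit_disc.
have mom : measurable_fun (plane (unit_disc R)) (fun w => omega (cplx w)).
  by apply/measurable_EFinP; exact: measurable_int iom.
have mfp : measurable_fun (plane (unit_disc R)) (fun w => (normc (f (cplx w)) `^ p * omega (cplx w))%R).
  apply: measurable_funM => //.
  by apply: (measurableT_comp (measurable_powR _)); exact: measurable_holo.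
pose G w : \bar R := (normc (f (cplx w)) `^ p * omega (cplx w))%:E.
have omge w : plane (unit_disc R) w -> (0 <= omega (cplx w))%R by move=> /om0/ltW.
have G0 w : plane (unit_disc R) w -> 0 <= G w.
  by move=> Dw; rewrite lee_fin mulr_ge0 ?powR_ge0 // omge.
have mG : measurable_fun (plane (unit_disc R)) G by exact/measurable_EFinP.
pose H := G \_ A.
have H0 w : 0 <= H w.
  by rewrite /H patchE; case: ifP => // /[!inE] /AD/G0.
have mGA : measurable_fun A G by exact: measurable_funS mG.
have mH : measurable_fun setT H by apply/(measurable_restrictT _ _).1.
have [mM EM] := ge0_integral_rotation_mean mH H0.
set M := (fun w => _) in mM EM.
have M0 w : 0 <= M w by apply: integral_ge0 => t _.
have tau0 : (0 < pi *+ 2 :> R)%R by rewrite mulrn_wgt0 // pi_gt0.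
set K : R := (1156 / (1 - r))%R.
have K0 : (0 <= K)%R by apply: divr_ge0; rewrite ?ler0n // subr_ge0 ltW.
have key w : A w -> (normc (f r%:C) `^ p)%:E * (omega (cplx w))%:E <= (K / (pi *+ 2))%:E * M w.
  move=> Aw; have /andP[rw w1] : (rho < normc (cplx w) < 1)%R by exact: Aw.
  set z := cplx w in rw w1 *.
  have om_z : (0 <= omega z)%R by apply: omge; exact: AD.
  have rz : (normc r%:C < normc z)%R by rewrite normc_real ger0_norm ?(ltW r0) // (lt_trans _ rw) // /rho; lra.
  have cg := continuous_circle p0 hf w1.
  have ig := cont_on_integrable (fun x _ => cg x : {for x, continuous _}) : mu.-integrable `[0%R, (pi *+ 2)%R] _.
  have MwE : M w = (omega z * \int[mu]_(t in `[0, pi *+ 2]) (normc (f (cis t * z)) `^ p))%:E.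
    rewrite EFinM /Rintegral fineK; last exact: integrable_fin_num.
    rewrite -ge0_integralZl_EFin //=; last 2 first.
      by move=> t _; rewrite lee_fin powR_ge0.
      by case/integrableP: ig.
    apply: eq_integral => t _; rewrite /H patchE.
    have -> : rot t w \in A.
      rewrite inE; suff : (rho < normc (cplx (rot t w)) < 1)%R by [].
      by rewrite cplx_rot normcM normc_cis mul1r; exact: Aw.
    by rewrite /G cplx_rot radial_cis // -EFinM mulrC.
  rewrite MwE -!EFinM lee_fin.
  have := circle_mean_bound p0 hf rz w1.
  set I := (\int[mu]_(t in _) _)%R => Hc.
  have I0 : (0 <= I)%R by apply: Rintegral_ge0 => t _; exact: powR_ge0.
  rewrite mulrCA mulrC; apply: ler_wpM2l => //.
  apply: (le_trans Hc); rewrite /K mulrA; apply: ler_wpM2r => //.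
  rewrite ler_pM2r ?invr_gt0 //.
  have z0 : (0 < normc z)%R by apply: lt_trans rw; rewrite /rho; lra.
  rewrite normc_real ger0_norm ?(ltW r0) //.
  have dz : (0 < 1 - r / normc z)%R by rewrite subr_gt0 ltr_pdivrMr // mul1r; move: rw; rewrite /rho; lra.
  rewrite ler_pdivrMr // mulrAC ler_pdivlMr ?subr_gt0 //.
  have H2 : (1 - r <= 2 * (1 - r / normc z))%R.
    (* 1 - r <= 2 (1 - r/|z|) for |z| >= (1+r)/2. *)
    have qz : (r / normc z * normc z = r)%R by rewrite divfK ?lt0r_neq0.
    have -> : (1 - r / normc z = (normc z - r) / normc z)%R by field; rewrite lt0r_neq0.
    rewrite mulrA ler_pdivlMr //.
    move: rw w1; rewrite /rho; nra.
  have -> : (1156 * (1 - r / normc z) = 578 * (2 * (1 - r / normc z)) :> R)%R by ring.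
  by rewrite ler_pM2l; [exact: H2|rewrite ltr0n].
rewrite /weight_mass /dA.
set k := NngNum _.
have k0 : (0 <= k%:num)%R by [].
rewrite ge0_integral_mscale //; last 2 first.
  by apply/measurable_EFinP; exact: measurable_funS mom.
  by move=> w /AD/omge; rewrite lee_fin.
rewrite ge0_integral_mscale //; last first.
rewrite muleCA [leRHS]muleCA; apply: lee_pmul => //.
- by apply: mule_ge0; [rewrite lee_fin powR_ge0|apply: integral_ge0 => w /AD/omge; rewrite lee_fin].
have JD : \int[mu2]_w H w <= \int[mu2]_(w in plane (unit_disc R)) G w.
  by rewrite /H -integral_mkcond; exact: ge0_subset_integral.
apply: (@le_trans _ _ (K%:E * \int[mu2]_w H w)); last by apply: lee_pmul => //; apply: integral_ge0.
rewrite -ge0_integralZl_EFin ?powR_ge0 //; last 2 first.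
  by move=> w /AD/omge; rewrite lee_fin.
  by apply/measurable_EFinP; exact: measurable_funS mom.
have -> : K%:E * \int[mu2]_w H w = \int[mu2]_w ((K / (pi *+ 2))%:E * M w).
  rewrite ge0_integralZl_EFin //; last by rewrite divr_ge0 // ltW.
  by rewrite EM muleA -EFinM divfK ?lt0r_neq0.
apply: (@le_trans _ _ (\int[mu2]_(w in A) ((K / (pi *+ 2))%:E * M w))).
  apply: ge0_le_integral => //.
  - by move=> w /AD/omge Hw; rewrite -EFinM lee_fin mulr_ge0 ?powR_ge0.
  - by apply: measurable_funeM; apply/measurable_EFinP; exact: measurable_funS mom.
  - by apply: measurable_funeM; exact: measurable_funS mM.
apply: ge0_subset_integral => //; first exact: measurable_funeM.
by move=> w _; rewrite mule_ge0 // lee_fin divr_ge0 // ltW.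
Qed.
End point_evaluation.

(** * The mass of an annulus *)

Section annulus_mass.
Variable R : realType.
Local Notation C := R[i].
Local Notation mu := (@lebesgue_measure R).
Local Notation mu2 := (@lebesgue_measure R \x @lebesgue_measure R)%E.

(** On the horizontal line at height [y] this is the distance to the origin.  As
    its derivative is at most 1, the substitution of the distance for the abscissa
    only decreases the integral of a nonnegative radial function.  For [y > 0] it
    is differentiable everywhere. *)
Definition hypotenuse (y x : R) : R := Num.sqrt (x ^+ 2 + y ^+ 2).

Lemma hypotenuse_gt0 (y x : R) : 0 < y -> 0 < hypotenuse y x.
Proof. by move=> y0; rewrite sqrtr_gt0 ltr_wpDl ?sqr_ge0 // exprn_gt0. Qed.

Lemma is_derive_hypotenuse (y x : R) : 0 < y -> is_derive x 1 (hypotenuse y) (x / hypotenuse y x).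
Proof.
move=> y0.
have s0 : 0 < x ^+ 2 + y ^+ 2 by rewrite ltr_wpDl ?sqr_ge0 // exprn_gt0.
have D1 : is_derive x 1 (fun x : R => x ^+ 2 + y ^+ 2) (x *+ 2).
  by apply: is_derive_eq; rewrite /GRing.scale /=; ring.
have D2 := is_derive1_sqrt s0.
have := @is_derive1_comp R Num.sqrt (fun x : R => x ^+ 2 + y ^+ 2) x _ _ D2 D1.
move=> H; apply: (is_derive_eq H); rewrite /hypotenuse mulr2n; field.
by rewrite lt0r_neq0 // sqrtr_gt0.
Qed.

Lemma derive_hypotenuse (y : R) : 0 < y -> (hypotenuse y)^`()%classic = (fun x => x / hypotenuse y x).
Proof. by move=> y0; apply/funext => x; rewrite derive1E; have [_ ->] := is_derive_hypotenuse x y0. Qed.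

Lemma continuous_hypotenuse (y : R) : 0 < y -> continuous (hypotenuse y).
Proof.
move=> y0 x; apply: differentiable_continuous; apply/derivable1_diffP.
by have [] := is_derive_hypotenuse x y0.
Qed.

Lemma continuous_derive_hypotenuse (y : R) : 0 < y -> continuous ((hypotenuse y)^`()%classic).
Proof.
move=> y0 x; rewrite derive_hypotenuse //; apply: cvgM; first exact: cvg_id.
by apply: cvgV; [rewrite lt0r_neq0 // hypotenuse_gt0|exact: continuous_hypotenuse].
Qed.

Lemma derive_hypotenuse_le1 (y x : R) : 0 < y -> 0 <= x -> (hypotenuse y)^`()%classic x <= 1.
Proof.
move=> y0 x0; rewrite derive_hypotenuse // ler_pdivrMr ?hypotenuse_gt0 // mul1r.
rewrite -[leLHS](ger0_norm x0) -sqrtr_sqr ler_sqrt ?lerDl ?sqr_ge0 //.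
by rewrite addr_ge0 ?sqr_ge0.
Qed.

Lemma hypotenuse_sqrtB (y s : R) : 0 <= s -> y ^+ 2 <= s ^+ 2 -> hypotenuse y (Num.sqrt (s ^+ 2 - y ^+ 2)) = s.
Proof.
move=> s0 ys; rewrite /hypotenuse sqr_sqrtr ?subr_ge0 // subrK sqrtr_sqr ger0_norm //.
Qed.

Lemma ge0_integral_hypotenuse_le (g : R -> R) (y s1 s2 : R) :
  0 < y -> y <= s1 -> s1 <= s2 ->
  cont_on s1 s2 g -> (forall s, s1 <= s <= s2 -> 0 <= g s) ->
  (\int[mu]_(s in `[s1, s2]) (g s)%:E <=
   \int[mu]_(x in `[Num.sqrt (s1 ^+ 2 - y ^+ 2), Num.sqrt (s2 ^+ 2 - y ^+ 2)]) (g (hypotenuse y x))%:E)%E.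
Proof.
move=> y0 ys1 s12 cg g0.
have s10 : 0 <= s1 by lra.
have ysq1 : y ^+ 2 <= s1 ^+ 2 by rewrite ler_sqr ?nnegrE //; lra.
have ssq : s1 ^+ 2 <= s2 ^+ 2 by rewrite ler_sqr ?nnegrE //; lra.
set a := Num.sqrt _; set b := Num.sqrt (s2 ^+ 2 - _).
have ab : a <= b by rewrite ler_sqrt ?subr_ge0 ?lerD2r // (le_trans ysq1).
have Fa : hypotenuse y a = s1 by rewrite hypotenuse_sqrtB.
have Fb : hypotenuse y b = s2 by rewrite hypotenuse_sqrtB ?(le_trans ysq1) // (le_trans s10).
have mono : {in `[a, b] &, {homo hypotenuse y : u v / u < v}}.
  move=> u v; rewrite !in_itv /= => /andP[au _] /andP[av _] uv.
  have u0 : 0 <= u := le_trans (sqrtr_ge0 _) au.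
  rewrite ltr_sqrt ?ltrD2r ?ltr_sqr ?nnegrE //; last by rewrite ltr_wpDl ?sqr_ge0 // exprn_gt0.
  by rewrite (le_trans u0) // ltW.
have mono' u v : a <= u -> u <= v -> v <= b -> hypotenuse y u <= hypotenuse y v.
  move=> au uv vb; move: uv; rewrite le_eqVlt => /predU1P[->//|uv].
  by apply/ltW/mono => //; rewrite in_itv /= ?au ?vb ?andbT //; lra.
have cd := continuous_derive_hypotenuse y0.
have ch := continuous_hypotenuse y0.
have cgw : {within `[hypotenuse y a, hypotenuse y b], continuous g}.
  by rewrite Fa Fb; apply: continuous_in_subspaceT => s; rewrite inE /= in_itv /=; exact: cg.
have dLR : derivable_oo_LRcontinuous (hypotenuse y) a b.
  split; first by move=> x _; have [] := is_derive_hypotenuse x y0.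
  - exact: cvg_at_right_filter (ch a).
  - exact: cvg_at_left_filter (ch b).
have hypotenuse_in x : a <= x <= b -> s1 <= hypotenuse y x <= s2.
  by move=> /andP[ax xb]; rewrite -Fa -Fb !mono'.
have cgh : cont_on a b (g \o hypotenuse y).
  by move=> x xab; apply: continuous_comp; [exact: ch|apply: cg; exact: hypotenuse_in].
have cghd : cont_on a b ((g \o hypotenuse y) * (hypotenuse y)^`()%classic).
  by move=> x xab; apply: continuousM; [exact: cgh|exact: cd].
have sub : (\int[mu]_(s in `[hypotenuse y a, hypotenuse y b]) (g s)%:E =
  \int[mu]_(x in `[a, b]) (((g \o hypotenuse y) * (hypotenuse y)^`()%classic) x)%:E)%E.
  apply: integration_by_substitution_increasing => //.
  - by apply/cvg_ex; exists ((hypotenuse y)^`()%classic a); exact: cvg_at_right_filter (cd a).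
  - by apply/cvg_ex; exists ((hypotenuse y)^`()%classic b); exact: cvg_at_left_filter (cd b).
rewrite -{1}Fa -{1}Fb sub.
have dle x : a <= x <= b -> 0 <= (hypotenuse y)^`()%classic x <= 1.
  move=> /andP[ax xb]; have x0 : 0 <= x := le_trans (sqrtr_ge0 _) ax.
  by rewrite derive_hypotenuse_le1 // andbT derive_hypotenuse // divr_ge0 // ltW // hypotenuse_gt0.
apply: ge0_le_integral => //=.
- move=> x; rewrite in_itv /= => xab; rewrite lee_fin mulr_ge0 //; last by case/andP: (dle x xab).
  exact/g0/hypotenuse_in.
- by have /integrableP[] := cont_on_integrable cghd.
- by have /integrableP[] := cont_on_integrable cgh.
- move=> x; rewrite in_itv /= => xab; rewrite lee_fin ler_piMr //; last by case/andP: (dle x xab).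
  exact/g0/hypotenuse_in.
Qed.

Lemma continuous_radial_profile (omega : C -> R) (s : R) :
  {for s%:C, continuous (omega : C^o -> R)} -> {for s, continuous (fun s : R => omega s%:C)}.
Proof.
move=> co; apply: (@continuous_comp _ _ _ (fun s : R => (s%:C : C^o)) (omega : C^o -> R)) => //.
apply/cvgrPdist_lt => e e0.
have [er eE] : 0 < complex.Re e /\ e = (complex.Re e)%:C.
  by move: e0; case: (e) => a b /=; rewrite ltcE /= => /andP[/eqP -> ].
apply/nbhs_ballP; exists (complex.Re e) => //= t; rewrite /ball /= => st.
by rewrite -rmorphB normC_E normc_real eE ltcR.
Qed.

(** Monotone convergence along closed intervals that exhaust the open one. *)
Lemma ge0_integral_oo_le (g : R -> R) (c d : R) (N : \bar R) : c < d ->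
  measurable_fun `]c, d[ g -> (forall s, c < s < d -> 0 <= g s) ->
  (forall s1 s2, c < s1 -> s1 <= s2 -> s2 < d -> (\int[mu]_(s in `[s1, s2]) (g s)%:E <= N)%E) ->
  (\int[mu]_(s in `]c, d[) (g s)%:E <= N)%E.
Proof.
move=> cd mg g0 H.
pose h n : R := (d - c) / n.+2%:R.
have n20 n : 0 < n.+2%:R :> R by rewrite ltr0n.
have h0 n : 0 < h n by rewrite divr_gt0 // subr_gt0.
have hle n : h n <= (d - c) / 2.
  by rewrite ler_pM2l ?subr_gt0 // lef_pV2 ?posrE // ler_nat.
have hmono n m : (n <= m)%N -> h m <= h n.
  by move=> nm; rewrite ler_pM2l ?subr_gt0 // lef_pV2 ?posrE // ler_nat !ltnS.
pose F n : set R := `[c + h n, d - h n]%classic.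
have FU : \bigcup_n F n = `]c, d[%classic.
  apply/seteqP; split => x; rewrite /F /=.
    by move=> [n _] /=; rewrite !in_itv /= => /andP[a b]; have ? := h0 n; apply/andP; split; lra.
  rewrite in_itv /= => /andP[cx xd].
  pose m := Num.min (x - c) (d - x).
  have m0 : 0 < m by rewrite lt_min !subr_gt0 cx.
  pose n := Num.truncn ((d - c) / m).
  have hn : h n <= m.
    rewrite ler_pdivrMr // mulrC -ler_pdivrMr //.
    by apply: ltW; apply: (lt_le_trans (truncnS_gt _)); rewrite ler_nat.
  have m1 : m <= x - c by rewrite ge_min lexx.
  have m2 : m <= d - x by rewrite ge_min lexx orbT.
  by exists n => //=; rewrite in_itv /=; apply/andP; split; lra.
have FS n : F n `<=` `]c, d[%classic by rewrite -FU => x Fx; exists n.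
have ndF : nondecreasing_seq F.
  move=> n m nm; apply/subsetPset => x; rewrite /F /= !in_itv /= => /andP[a b].
  by have ? := hmono _ _ nm; apply/andP; split; lra.
rewrite -FU.
have cv : (\int[mu]_(x in F n) (g x)%:E)%E @[n --> \oo] --> (\int[mu]_(x in \bigcup_n F n) (g x)%:E)%E.
  apply: ge0_nondecreasing_set_cvg_integral => //.
  - by move=> n; exact: measurable_itv.
  - by move=> n; apply/measurable_EFinP; exact: (measurable_funS _ (FS n) mg).
  - by move=> n x /FS /=; rewrite in_itv /= lee_fin; exact: g0.
apply: (cvge_to_le cv).
by apply: nearW => n; have ? := h0 n; have ? := hle n; apply: H; lra.
Qed.

Local Open Scope ereal_scope.

(** Only the strip 0 < y <= 1/4 is kept.  Each of its horizontal lines meets the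
    annulus, and contributes at least the radial integral. *)
Lemma annulus_mass_ge (omega : C -> R) (rho : R) : (1 / 2 <= rho < 1)%R ->
  weight omega -> radial omega ->
  (forall z, unit_disc R z -> {for z, continuous (omega : C^o -> R)}) ->
  ((pi *+ 4)^-1)%:E * \int[mu]_(s in `]rho, 1%R[) (omega s%:C)%:E <= weight_mass omega (annulus rho).
Proof.
move=> /andP[rho2 rho1] [om0 iom] rom com.
set A := plane (annulus rho).
have mA : measurable A by exact: measurable_normc_lt.
have AD : A `<=` plane (unit_disc R) := @annulus_disc R rho.
have mom : measurable_fun (plane (unit_disc R)) (fun w => omega (cplx w)).
  by apply/measurable_EFinP; exact: measurable_int iom.
pose G (w : R2 R) : \bar R := (omega (cplx w))%:E.
have mGD : measurable_fun (plane (unit_disc R)) G by exact/measurable_EFinP.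
have mD := @measurable_unit_disc R.
have mG : measurable_fun A G by exact: measurable_funS mGD.
have G0 w : A w -> 0 <= G w by move=> /AD/om0/ltW; rewrite lee_fin.
pose H := G \_ A.
have H0 w : 0 <= H w by rewrite /H patchE; case: ifP => // /[!inE] /G0.
have mH : measurable_fun setT H by apply/(measurable_restrictT _ _).1.
pose g (s : R) := omega s%:C.
have real_disc (s : R) : (`|s| < 1)%R -> unit_disc R s%:C.
  by move=> s1; apply/unit_discE; rewrite normc_real.
have cg s : (`|s| < 1)%R -> {for s, continuous g}.
  by move=> s1; apply: continuous_radial_profile; apply: com; exact: real_disc.
have g0 s : (`|s| < 1)%R -> (0 <= g s)%R by move=> /real_disc/om0/ltW.
set J := \int[mu]_(s in _) _.
have mg : measurable_fun `]rho, 1%R[ g.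
  apply: subspace_continuous_measurable_fun => //.
  apply: continuous_in_subspaceT => s; rewrite inE /= in_itv /= => /andP[a b].
  by apply: cg; rewrite ltr_norml; apply/andP; split; lra.
have J0 : 0 <= J.
  apply: integral_ge0 => s /=; rewrite in_itv /= => /andP[a b]; rewrite lee_fin.
  by apply: g0; rewrite ltr_norml; apply/andP; split; lra.
have slice (y : R) : (0 < y)%R -> (y <= 1 / 4)%R -> J <= \int[mu]_x H (x, y).
  move=> y0 y4; apply: ge0_integral_oo_le => //.
    by move=> s /andP[a b]; apply: g0; rewrite ltr_norml; apply/andP; split; lra.
  move=> s1 s2 r1 s12 r2.
  have ys : (y <= s1)%R by lra.
  apply: (le_trans (ge0_integral_hypotenuse_le y0 ys s12 _ _)).
  - by move=> s /andP[a b]; apply: cg; rewrite ltr_norml; apply/andP; split; lra.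
  - by move=> s /andP[a b]; apply: g0; rewrite ltr_norml; apply/andP; split; lra.
  set a := Num.sqrt _; set b := Num.sqrt (s2 ^+ 2 - _).
  have s10 : (0 <= s1)%R by lra.
  have ysq1 : (y ^+ 2 <= s1 ^+ 2)%R by rewrite ler_sqr ?nnegrE //; lra.
  have ssq : (s1 ^+ 2 <= s2 ^+ 2)%R by rewrite ler_sqr ?nnegrE //; lra.
  have inA x : (a <= x <= b)%R -> A (x, y) /\ omega (cplx (x, y)) = g (hypotenuse y x).
    move=> /andP[ax xb].
    have x0 : (0 <= x)%R := le_trans (sqrtr_ge0 _) ax.
    have nE : normc (cplx (x, y)) = hypotenuse y x by [].
    have l1 : (s1 <= hypotenuse y x)%R.
      rewrite -(hypotenuse_sqrtB s10 ysq1) -/a /hypotenuse ler_sqrt ?addr_ge0 ?sqr_ge0 //.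
      by rewrite lerD2r ler_sqr ?nnegrE // sqrtr_ge0.
    have l2 : (hypotenuse y x <= s2)%R.
      rewrite -(hypotenuse_sqrtB (le_trans s10 s12) (le_trans ysq1 ssq)) -/b /hypotenuse ler_sqrt ?addr_ge0 ?sqr_ge0 //.
      by rewrite lerD2r ler_sqr ?nnegrE // sqrtr_ge0.
    have Axy : (rho < normc (cplx (x, y)) < 1)%R by rewrite nE; apply/andP; split; lra.
    split; first exact: Axy.
    by rewrite rom ?nE //; apply/unit_discE; case/andP: Axy.
  have sl : measurable_fun setT (fun x : measurableTypeR R => H (x, y)).
    by apply: (measurableT_comp mH); exact: measurable_fun_pair.
  have -> : \int[mu]_(x in `[a, b]) (g (hypotenuse y x))%:E = \int[mu]_(x in `[a, b]) H (x, y).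
    apply: eq_integral => x; rewrite inE /= in_itv /= => /inA[Ax E].
    by rewrite /H patchE mem_set // /G E.
  by apply: ge0_subset_integral => //; exact: measurable_itv.
rewrite /weight_mass /dA.
set k := NngNum _.
rewrite ge0_integral_mscale //.
have -> : (pi *+ 4 : R)^-1%:E * J = k%:num%:E * ((4^-1)%:E * J).
  by rewrite muleA -EFinM /= -invfM mulr_natr.
apply: lee_pmul => //; first by rewrite mule_ge0 // lee_fin invr_ge0.
rewrite integral_mkcond -/H.
rewrite [leRHS](_ : _ = \int[mu]_y \int[mu]_x H (x, y)); last exact: (fubini_tonelli2 H).
have mS : measurable_fun setT (fun y : measurableTypeR R => \int[mu]_x H (x, y)).
  exact: (measurable_fun_fubini_tonelli_G H).
apply: (@le_trans _ _ (\int[mu]_(y in `]0%R, (1 / 4)%R]) \int[mu]_x H (x, y))); last first.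
  by apply: ge0_subset_integral => // y _; exact: integral_ge0.
apply: (@le_trans _ _ (\int[mu]_(y in `]0%R, (1 / 4)%R]) J)).
  rewrite integral_cst; last exact: measurable_itv.
  rewrite muleC le_eqVlt; apply/orP; left; apply/eqP; congr (_ * _); symmetry.
  have := @lebesgue_measure_itv R `]0%R, (1 / 4)%R].
  by rewrite /= lte_fin divr_gt0 // sube0 div1r.
apply: ge0_le_integral => //; first exact: measurable_funS mS.
by move=> y /=; rewrite in_itv /= => /andP[y0 y4]; exact: slice.
Qed.
End annulus_mass.

(** * Evaluation at points where the disc is light *)

Section small_discs.
Variable R : realType.
Local Notation C := R[i].
Local Notation mu := (@lebesgue_measure R).
Local Notation mu2 := (@lebesgue_measure R \x @lebesgue_measure R)%E.
Local Open Scope ereal_scope.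

Lemma measurable_disc (a : C) (d : R) : measurable (plane (disc a d)).
Proof.
apply: box_measurable => w; rewrite /plane /disc /= => wd.
exists ((d - normc (cplx w - a)) / 2)%R; first by rewrite divr_gt0 // subr_gt0.
move=> z /normc_cplxB H /=.
have := le_normcD (cplx z - cplx w)%R (cplx w - a)%R; rewrite addrA subrK; lra.
Qed.

Lemma dA_disc_le (r d : R) : (0 <= d)%R ->
  @dA R (plane (disc r%:C d)) <= (4 / pi * d ^+ 2)%:E.
Proof.
move=> d0; pose B : set (R2 R) := box (r, 0%R) d.
have mB : measurable B by apply: measurableX; exact: measurable_itv.
have DB : plane (disc r%:C d) `<=` B.
  move=> [x y] H; have {}H : (normc ((x +i* y) - r%:C) < d)%R by exact: H.
  have := le_lt_trans (Re_le_normc _) H; have := le_lt_trans (Im_le_normc _) H.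
  rewrite /= oppr0 addr0 !ltr_norml => H1 H2.
  by rewrite /B /box /= !in_itv /=; split; apply/andP; split; lra.
apply: (@le_trans _ _ (@dA R B)).
  by apply: le_measure => //; rewrite inE //; exact: measurable_disc.
rewrite /dA /mscale /= /mscale /=.
have itvE (c : R) : mu `](c - d)%R, (c + d)%R[ = (2 * d)%:E.
  have := @lebesgue_measure_itv R `](c - d)%R, (c + d)%R[; rewrite /= lte_fin => ->.
  case: ifP => [_|]; first by rewrite -EFinB; congr EFin; ring.
  by move=> /negbT; rewrite -leNgt => H; congr EFin; lra.
have -> : mu2 B = (2 * d)%:E * (2 * d)%:E.
  etransitivity; first exact: (@product_measure1E _ _ _ _ R mu mu _ _ (measurable_itv _) (measurable_itv _)).
  by congr (_ * _); exact: itvE.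
by rewrite -!EFinM lee_fin le_eqVlt; apply/orP; left; apply/eqP; ring.
Qed.

(** The radii in the disc range over (r - beta (1-r), r + beta (1-r)), which is
    within reach of the comparability of omega for s = beta: going down from r to
    t one has 1 - r >= (1 - beta)(1 - t), because (1 - beta)(1 + beta) <= 1. *)
Lemma disc_mass_le (omega : C -> R) (beta : R) : class_I_tilde omega -> (0 < beta < 1)%R ->
  exists2 K : R, (0 < K)%R & forall r : R, (1 / 2 <= r < 1)%R ->
    weight_mass omega (disc r%:C (beta * (1 - normc r%:C))) <= (K * (omega r%:C * (1 - r) ^+ 2))%:E.
Proof.
move=> [[[om0 iom] rom _ _] tl] /andP[b0 b1].
have [|K K1 HK] := tl beta; first by rewrite ltW.
have pi0 : (0 < pi :> R)%R := pi_gt0 R.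
exists (K * (4 / pi))%R; first by rewrite mulr_gt0 ?divr_gt0 //; lra.
move=> r /andP[r2 r1].
have K0 : (0 < K)%R by lra.
rewrite normc_real ger0_norm; last lra.
set d := (beta * (1 - r))%R.
have d0 : (0 <= d)%R by rewrite /d mulr_ge0 //; lra.
have dr : (d <= 1 - r)%R by rewrite /d; nra.
set D := plane (disc r%:C d).
have mD : measurable D by exact: measurable_disc.
have near_r w : D w -> (`|normc (cplx w) - r| < d)%R.
  move=> Dw; have {}Dw : (normc (cplx w - r%:C) < d)%R by exact: Dw.
  have rr : normc r%:C = r by rewrite normc_real ger0_norm //; lra.
  have := ler_normcB (cplx w) r%:C; have := ler_normcB r%:C (cplx w).
  rewrite -(normcN (r%:C - cplx w)%R) opprB rr ltr_norml; lra.
have DD : D `<=` plane (unit_disc R).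
  by move=> w /near_r; rewrite ltr_norml => ?; apply/unit_discE; lra.
have omD w : D w -> (omega (cplx w) <= K * omega r%:C)%R.
  move=> Dw; rewrite rom; last exact: DD.
  have := near_r w Dw; rewrite ltr_norml; set t := normc (cplx w) => /andP[t1 t2].
  have t0 : (0 <= t)%R by exact: normc_ge0.
  have [tr|rt] := leP t r.
    have h1 : (r <= t + beta * (1 - t))%R by rewrite /d in t1; nra.
    have h2 : (t + beta * (1 - t) < 1)%R by nra.
    by have /andP[] := HK t r t0 tr h1 h2.
  have rd : (r + beta * (1 - r) < 1)%R by nra.
  have := HK r t ltac:(lra) (ltW rt) ltac:(rewrite /d in t2; lra) rd.
  by move=> /andP[+ _]; rewrite ler_pdivrMl.
have omr : (0 < omega r%:C)%R.
  by apply: om0; apply/unit_discE; rewrite normc_real ger0_norm; lra.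
rewrite /weight_mass -/D.
apply: (@le_trans _ _ (\int[@dA R]_(w in D) (K * omega r%:C)%:E)).
  apply: ge0_le_integral => //.
  - by move=> w /DD/om0/ltW; rewrite lee_fin.
  - exact: (measurable_funS (@measurable_unit_disc R) DD (measurable_int _ iom)).
rewrite integral_cst //.
apply: (@le_trans _ _ ((K * omega r%:C)%:E * (4 / pi * d ^+ 2)%:E)).
  by apply: lee_pmul => //; [rewrite lee_fin mulr_ge0 // ltW|exact: dA_disc_le].
rewrite -EFinM lee_fin.
have -> : (K * (4 / pi) * (omega r%:C * (1 - r) ^+ 2) = K * omega r%:C * (4 / pi * (1 - r) ^+ 2))%R by ring.
apply: ler_wpM2l; first by rewrite mulr_ge0 // ltW.
apply: ler_wpM2l; first by rewrite divr_ge0 // ltW.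
by rewrite ler_sqr ?nnegrE //; lra.
Qed.

(** With rho = (1+r)/2 the product M W is a constant times (1-rho)/psi(rho), by
    [point_evaluation], [annulus_mass_ge] and [disc_mass_le]; the factor omega(r)
    cancels against omega(rho), since the two are comparable. *)
Lemma small_disc_evaluation (omega : C -> R) (p beta : R) :
  (0 < p)%R -> (0 < beta < 1)%R -> class_I_tilde omega ->
  forall eps : R, (0 < eps)%R -> exists r M W : R,
  [/\ (0 < r < 1)%R, (0 < M)%R, (0 < W)%R & (M * W <= eps)%R] /\
  (weight_mass omega (disc r%:C (beta * (1 - normc r%:C))) <= W%:E /\
  forall f, analytic_in_disc f ->
    (normc (f r%:C) `^ p)%:E <= M%:E * \int[@dA R]_(w in plane (unit_disc R))
     (normc (f (cplx w)) `^ p * omega (cplx w))%:E).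
Proof.
move=> p0 b01 tl eps e0.
have [K2 K20 HW] := disc_mass_le tl b01.
have [[wom rom com psi_oo] til] := tl.
have [|C1 C11 HC1] := til (1 / 2)%R; first lra.
have pi0 : (0 < pi :> R)%R := pi_gt0 R.
have p40 : (0 < pi *+ 4 :> R)%R by rewrite mulrn_wgt0.
have [N [NE N0]] : exists N : R, N = 1156%R /\ (0 < N)%R by exists 1156%R; rewrite ltr0n.
(* [T / B] is the product M W that results from a lower bound [B] of
   psi(rho)/(1-rho): 4 pi from the annulus, 2 from 1 - rho = (1-r)/2, C1 from
   comparing omega(r) with omega(rho), K2 from the disc. *)
pose T : R := (N * 8 * pi * C1 * K2)%R.
have T0 : (0 < T)%R.
  by rewrite /T; do ?[apply: mulr_gt0]; rewrite ?ltr0n //; apply: lt_trans C11.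
pose B := (T / eps)%R.
have B0 : (0 < B)%R by rewrite divr_gt0.
have psiB : \forall r \near 1%R^'-, (B <= psi omega r / (1 - r))%R.
  by move/cvgryPge : psi_oo => /(_ B).
have [rho [[Hpsi rho4] rho1]] : exists rho : R, ((B <= psi omega rho / (1 - rho))%R /\ (3 / 4 < rho)%R) /\ (rho < 1)%R.
  apply: (@filter_ex _ (1%R^'-)); apply: filterI; first apply: filterI => //.
    by apply: nbhs_left_gt; lra.
  exact: nbhs_left_lt.
pose r := (2 * rho - 1)%R.
have rhoE : rho = ((1 + r) / 2)%R by rewrite /r; field.
have r2 : (1 / 2 <= r)%R by rewrite /r; lra.
have r1 : (r < 1)%R by rewrite /r; lra.
have real_disc (s : R) : (0 <= s < 1)%R -> (0 < omega s%:C)%R.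
  by move=> /andP[s0 s1]; apply: wom.1; apply/unit_discE; rewrite normc_real ger0_norm.
have omr : (0 < omega r%:C)%R by apply: real_disc; lra.
have omrho : (0 < omega rho%:C)%R by apply: real_disc; lra.
have om_le : (omega r%:C <= C1 * omega rho%:C)%R.
  by have /andP[] := HC1 r rho ltac:(lra) ltac:(rewrite /r; lra) ltac:(rewrite /r; lra) ltac:(lra).
set J := \int[mu]_(s in `]rho, 1%R[) (omega s%:C)%:E.
have J0 : 0 <= J.
  apply: integral_ge0 => s /=; rewrite in_itv /= => /andP[s1 s2]; rewrite lee_fin.
  by apply/ltW/real_disc; lra.
have JB : (B * (1 - rho) * omega rho%:C)%:E <= J.
  have H : (B * (1 - rho) * omega rho%:C <= fine J)%R.
    move: Hpsi; rewrite /psi ler_pdivlMr ?subr_gt0 // => H.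
    rewrite -ler_pdivlMr //; apply: le_trans H _.
    by rewrite mulrC.
  have [Jf|] := boolP (J \is a fin_num); first by rewrite -(fineK Jf) lee_fin.
  by rewrite ge0_fin_numE // -leNgt leye_eq => /eqP ->; exact: leey.
have mass : ((pi *+ 4)^-1 * (B * (1 - rho) * omega rho%:C))%:E <= weight_mass omega (annulus rho).
  apply: le_trans (annulus_mass_ge _ wom rom com); last lra.
  by rewrite EFinM lee_pmul2l // lte_fin invr_gt0.
pose m0 : R := ((pi *+ 4)^-1 * (B * ((1 - r) / 2) * (omega r%:C / C1)))%R.
have C10 : (0 < C1)%R by lra.
have m00 : (0 < m0)%R.
  by rewrite /m0; do ?[apply: mulr_gt0]; rewrite ?invr_gt0 ?subr_gt0 ?ltr0n.
have m0mass : m0%:E <= weight_mass omega (annulus rho).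
  apply: le_trans mass; rewrite lee_fin ler_wpM2l ?invr_ge0 ?(ltW p40) //.
  apply: ler_pM.
  - by apply: mulr_ge0; [exact: ltW|lra].
  - by apply: divr_ge0; exact: ltW.
  - by rewrite ler_pM2l // /r; lra.
  - by rewrite ler_pdivrMr // mulrC.
exists r, (N / (1 - r) / m0)%R, (K2 * (omega r%:C * (1 - r) ^+ 2))%R.
have r10 : (0 < 1 - r)%R by rewrite subr_gt0.
split.
  split.
  - by apply/andP; split; lra.
  - by rewrite !divr_gt0.
  - by rewrite !mulr_gt0 // exprn_gt0.
  - rewrite le_eqVlt; apply/orP; left; apply/eqP.
    have h1 : (1 - r != 0)%R by rewrite lt0r_neq0.
    have h2 : (omega r%:C != 0)%R by rewrite lt0r_neq0.
    have h3 : (pi != 0 :> R)%R by rewrite lt0r_neq0.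
    have h4 : (C1 != 0)%R by rewrite lt0r_neq0.
    have h5 : (K2 != 0)%R by rewrite lt0r_neq0.
    have h6 : (eps != 0)%R by rewrite lt0r_neq0.
    have h7 : (N != 0)%R by rewrite lt0r_neq0.
    rewrite /m0 /B /T -mulr_natr; move: (pi) (omega _) (1 - r)%R h1 h2 h3 => x y z h1 h2 h3.
    by field; rewrite h1 h2 h3 h4 h5 h6 h7.
split; first by apply: HW; rewrite r2.
move=> f hf.
have := @point_evaluation R f p r omega p0 _ wom rom hf.
rewrite -rhoE -NE => PE; have {}PE := PE ltac:(lra).
set I := \int[_]_(w in _) _ in PE *.
have I0 : 0 <= I.
  apply: integral_ge0 => w Dw; rewrite lee_fin mulr_ge0 ?powR_ge0 //.
  exact/ltW/wom.1.
have F0 : 0 <= (normc (f r%:C) `^ p)%:E by rewrite lee_fin powR_ge0.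
have {}PE : (normc (f r%:C) `^ p)%:E * m0%:E <= (N / (1 - r))%:E * I.
  by apply: le_trans PE; apply: lee_pmul => //; rewrite lee_fin ltW.
have -> : (N / (1 - r) / m0)%:E * I = m0^-1%:E * ((N / (1 - r))%:E * I).
  by rewrite muleA -EFinM mulrC.
have m0i : 0 <= m0^-1%:E by rewrite lee_fin invr_ge0 ltW.
apply: le_trans (lee_pmul m0i _ (lexx _) PE); last by rewrite mule_ge0 // lee_fin ltW.
by rewrite muleCA -!EFinM mulVf ?mulr1 ?lt0r_neq0.
Qed.
End small_discs.

(** * Measures supported by a sequence *)

Section atoms.
Variable R : realType.
Local Notation C := R[i].
Local Open Scope ereal_scope.

Definition atomic_measure (c : nat -> {nonneg R}) (a : nat -> R2 R) : {measure set (R2 R) -> \bar R} :=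
  mseries (fun k => mscale (c k) (dirac (a k))) 0.

Lemma atomic_measureE (c : nat -> {nonneg R}) (a : nat -> R2 R) (A : set (R2 R)) :
  atomic_measure c a A = \sum_(0 <= k <oo) ((c k)%:num * (a k \in A)%:R)%:E.
Proof.
rewrite /atomic_measure /mseries; apply: eq_eseriesr => k _.
by rewrite /= /mscale /= diracE EFinM.
Qed.

Lemma atomic_measure_ge (c : nat -> {nonneg R}) (a : nat -> R2 R) (A : set (R2 R)) k :
  A (a k) -> (c k)%:num%:E <= atomic_measure c a A.
Proof.
move=> Aa; rewrite atomic_measureE.
apply: le_trans (nneseries_lim_ge k.+1 _); last first.
  by move=> n _ _; rewrite lee_fin mulr_ge0.
rewrite big_nat_recr //= mem_set // mulr1.
apply: leeDr; apply: sume_ge0 => n _; rewrite lee_fin mulr_ge0 //.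
Qed.

Lemma atomic_measure0 (c : nat -> {nonneg R}) (a : nat -> R2 R) (A : set (R2 R)) :
  (forall k, A (a k)) -> atomic_measure c a (~` A) = 0.
Proof.
move=> Aa; rewrite atomic_measureE eseries0 // => k _ _.
by rewrite memNset ?mulr0 //=; exact.
Qed.

Lemma integral_atomic_measure (c : nat -> {nonneg R}) (a : nat -> R2 R) (D : set (R2 R))
    (f : R2 R -> \bar R) : measurable D -> measurable_fun D f ->
  (forall w, D w -> 0 <= f w) -> (forall k, D (a k)) ->
  \int[atomic_measure c a]_(w in D) f w = \sum_(0 <= k <oo) ((c k)%:num%:E * f (a k)).
Proof.
move=> mD mf f0 Da; rewrite ge0_integral_measure_series //.
apply: eq_eseriesr => k _.
by rewrite ge0_integral_mscale // integral_dirac // diracE mem_set // mul1e.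
Qed.

Lemma half_series_scale (V : R) :
  \sum_(0 <= k <oo) (((2 ^+ k.+1)^-1)%:E * V%:E) = V%:E.
Proof.
rewrite (eq_eseriesr (fun k _ => muleC _ _)) nneseriesZl; last by move=> k _; rewrite lee_fin invr_ge0 exprn_ge0.
suff -> : \sum_(0 <= k <oo) ((2 ^+ k.+1)^-1)%:E = 1 :> \bar R by rewrite mule1.
apply/cvg_lim => //.
have := @cvg_geometric_series_half R 1 0; rewrite {1}/series /= expr0 divr1.
under [in X in _ -> X]eq_fun do rewrite sumEFin.
move=> H; apply: (@cvg_comp _ _ _ _ EFin _ (nbhs (1%R : R))) => //.
apply: cvg_trans H; apply: near_eq_cvg; apply: nearW => n.
by apply: eq_bigr => i _; rewrite addn1 natrX div1r.
Qed.
(** The k-th atom contributes at most 2^-(k+1) times the q-th power of the norm of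
    [f]. *)
Lemma carleson_atomic_measure (p q : R) (omega : C -> R) (c : nat -> {nonneg R})
    (a : nat -> R2 R) (M : nat -> R) :
  (0 < p)%R -> (0 < q)%R -> weight omega ->
  (forall k, plane (unit_disc R) (a k)) -> (forall k, (0 < M k)%R) ->
  (forall k f, analytic_in_disc f ->
    (normc (f (cplx (a k))) `^ p)%:E <= (M k)%:E *
      \int[@dA R]_(w in plane (unit_disc R))
        (normc (f (cplx w)) `^ p * omega (cplx w))%:E) ->
  (forall k, (c k)%:num * M k `^ (q / p) <= (2 ^+ k.+1)^-1)%R ->
  carleson_measure p q omega (atomic_measure c a).
Proof.
move=> p0 q0 [om0 _] aD M0 pe cM.
have g0 : (0 < q / p)%R by rewrite divr_gt0.
split; first exact: atomic_measure0.
exists 1%R => f [hf]; rewrite mul1e /bergman_norm.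
set I := \int[_]_(w in _) _ => fin.
have I0 : 0 <= I.
  apply: integral_ge0 => w Dw; rewrite lee_fin mulr_ge0 ?powR_ge0 //.
  exact/ltW/om0.
have If : I \is a fin_num.
  by rewrite ge0_fin_numE //; apply: lty_poweRy fin; rewrite invr_eq0 lt0r_neq0.
pose x := fine I; have Ix : I = x%:E by rewrite /x fineK.
have x0 : (0 <= x)%R by rewrite -lee_fin -Ix.
have main : \int[atomic_measure c a]_(w in plane (unit_disc R))
    (normc (f (cplx w)) `^ q)%:E <= (x `^ (q / p))%:E.
  rewrite integral_atomic_measure //; first last.
  - by move=> w _; rewrite lee_fin powR_ge0.
  - apply/measurable_EFinP; apply: (measurableT_comp (measurable_powR _)).
    exact: measurable_holo.
  - exact: measurable_unit_disc.
  rewrite -[leRHS]half_series_scale; apply: lee_nneseries.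
    by move=> k _ _; rewrite mule_ge0 // lee_fin powR_ge0.
  move=> k _; rewrite -!EFinM lee_fin.
  have fk : (normc (f (cplx (a k))) `^ q <= M k `^ (q / p) * x `^ (q / p))%R.
    rewrite -powRM ?(ltW (M0 k)) //.
    have {1}-> : q = (p * (q / p))%R by rewrite mulrCA divff ?mulr1 // lt0r_neq0.
    rewrite powRrM; apply: ge0_ler_powR.
    - exact: ltW.
    - by rewrite nnegrE powR_ge0.
    - by rewrite nnegrE mulr_ge0 // ltW.
    - by have := pe k f hf; rewrite -/I Ix -EFinM lee_fin.
  apply: (le_trans (ler_wpM2l _ fk)) => //.
  by rewrite mulrA; apply: ler_wpM2r => //; exact: powR_ge0.
rewrite /Lq_norm Ix; apply: (@le_trans _ _ ((x `^ (q / p))%:E `^ q^-1)).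
  apply: gt0_ler_poweR; last exact: main.
  - by rewrite invr_ge0 ltW.
  - by rewrite in_itv /= leey andbT; apply: integral_ge0 => w _; rewrite lee_fin powR_ge0.
  - by rewrite in_itv /= leey lee_fin powR_ge0.
rewrite !poweR_EFin lee_fin -powRrM.
by rewrite mulrAC divff ?mul1r ?lt0r_neq0.
Qed.

(** The disc around an atom has at least the mass of that atom. *)
Lemma atomic_quotients_unbounded (g beta : R) (omega : C -> R) (c : nat -> {nonneg R})
    (a : nat -> R2 R) (W : nat -> R) :
  (0 < g)%R -> (0 < beta < 1)%R -> weight omega ->
  (forall k, plane (unit_disc R) (a k)) -> (forall k, (0 < W k)%R) ->
  (forall k, weight_mass omega
     (disc (cplx (a k)) (beta * (1 - normc (cplx (a k))))) <= (W k)%:E) ->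
  (forall k, k.+1%:R <= (c k)%:num / W k `^ g)%R ->
  ~ (ereal_sup
       [set atomic_measure c a (plane (disc z (beta * (1 - normc z)))) /
            (weight_mass omega (disc z (beta * (1 - normc z)))) `^ g
       | z in unit_disc R] < +oo).
Proof.
move=> g0 /andP[b0 b1] [om0 _] aD W0 Wm cW.
set S := ereal_sup _ => Sfin.
have big k : k.+1%:R%:E <= S.
  pose z := cplx (a k).
  have z1 : (normc z < 1)%R by apply/unit_discE; exact: aD.
  pose Dk := disc z (beta * (1 - normc z)).
  apply: (@le_trans _ _ (atomic_measure c a (plane Dk) / (weight_mass omega Dk) `^ g)); last first.
    by apply: ereal_sup_ubound; exists z => //; exact: aD.
  have cD : (c k)%:num%:E <= atomic_measure c a (plane Dk).
    apply: atomic_measure_ge.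
    suff H : (normc (cplx (a k) - z) < beta * (1 - normc z))%R by exact: H.
    by rewrite subrr normc0 mulr_gt0 // subr_gt0.
  have wm0 : 0 <= weight_mass omega Dk.
    apply: integral_ge0 => w Dw; rewrite lee_fin; apply/ltW/om0/unit_discE.
    have {}Dw : (normc (cplx w - z) < beta * (1 - normc z))%R by exact: Dw.
    have := le_normcD (cplx w - z)%R z; rewrite subrK; nra.
  have Wg : (weight_mass omega Dk) `^ g <= (W k `^ g)%:E.
    rewrite -poweR_EFin; apply: gt0_ler_poweR; rewrite ?(ltW g0) //.
    - by rewrite in_itv /= wm0 leey.
    - by rewrite in_itv /= leey lee_fin ltW.
    - exact: Wm.
  apply: (@le_trans _ _ ((c k)%:num%:E * ((W k `^ g)%:E)^-1)).
    by rewrite inver gt_eqF ?powR_gt0 // -EFinM lee_fin.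
  apply: lee_pmul.
  - by rewrite lee_fin.
  - by rewrite inve_ge0 lee_fin powR_ge0.
  - exact: cD.
  - by rewrite lee_pV2 ?inE //= ?lee_fin ?powR_ge0 ?poweR_ge0.
have S0 : 0 <= S by apply: le_trans (big 0%N); rewrite lee_fin.
have Sf : S \is a fin_num by rewrite ge0_fin_numE.
have := big (Num.truncn (fine S)); rewrite -(fineK Sf) lee_fin leNgt.
by rewrite truncnS_gt.
Qed.
End atoms.

Local Open Scope ereal_scope.

Theorem proposition2p6 (R : realType) (p q beta : R) (omega : R[i] -> R)
  (hp : (0 < p)%R) (hpq : (p <= q)%R) (homega : class_I_tilde omega)
  (hbeta : (0 < beta < 1)%R) :
  exists mu : {measure set (R2 R) -> \bar R},
    carleson_measure p q omega mu /\
    ~ (ereal_sup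
         [set mu (plane (disc a (beta * (1 - normc a)))) /
              (weight_mass omega (disc a (beta * (1 - normc a)))) `^ (q / p)
         | a in unit_disc R] < +oo).
Proof.
have q0 : (0 < q)%R := lt_le_trans hp hpq.
have g0 : (0 < q / p)%R by rewrite divr_gt0.
(* If (M W)^(q/p) <= 1 / t k, the k-th quotient is at least
   2^-(k+1) t k = k + 1. *)
pose t (k : nat) : R := (k.+1%:R * 2 ^+ k.+1)%R.
have t0 k : (0 < t k)%R by rewrite mulr_gt0 ?ltr0n ?exprn_gt0.
pose eps k : R := ((t k)^-1 `^ (q / p)^-1)%R.
have eps0 k : (0 < eps k)%R by rewrite powR_gt0 // invr_gt0.
have epsE k : (eps k `^ (q / p) = (t k)^-1)%R.
  by rewrite -powRrM mulVf ?lt0r_neq0 // powRr1 // invr_ge0 ltW.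
have [r] := choice (fun k => small_disc_evaluation hp hbeta homega (eps0 k)).
move=> /choice[M] /choice[W rMW].
have r01 k : (0 < r k < 1)%R by have [[]] := rMW k.
have M0 k : (0 < M k)%R by have [[]] := rMW k.
have W0 k : (0 < W k)%R by have [[]] := rMW k.
have MW k : (M k * W k <= eps k)%R by have [[]] := rMW k.
have p2 k : (0 < 2 ^+ k.+1 :> R)%R by rewrite exprn_gt0.
have c_ge0 k : (0 <= (2 ^+ k.+1)^-1 * (M k `^ (q / p))^-1)%R.
  by rewrite mulr_ge0 // invr_ge0 ?exprn_ge0 ?powR_ge0.
pose c k : {nonneg R} := NngNum (c_ge0 k).
pose a k : R2 R := (r k, 0%R).
have wom : weight omega by case: homega => -[].
have aD k : plane (unit_disc R) (a k).
  have /andP[r0 r1] := r01 k.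
  by apply/unit_discE; rewrite normc_real ger0_norm // ltW.
exists (atomic_measure c a); split.
  apply: (carleson_atomic_measure hp q0 wom aD M0) => k.
    by have [_ [_]] := rMW k.
  by rewrite /= mulfVK // lt0r_neq0 // powR_gt0.
apply: (atomic_quotients_unbounded g0 hbeta wom aD W0) => k.
  by have [_ []] := rMW k.
have MWg : ((M k * W k) `^ (q / p) <= (t k)^-1)%R.
  rewrite -epsE; apply: ge0_ler_powR (MW k); rewrite ?nnegrE; first exact: ltW.
    by rewrite mulr_ge0 ?(ltW (M0 k)) ?(ltW (W0 k)).
  exact: ltW.
have tk : (t k <= ((M k * W k) `^ (q / p))^-1)%R.
  by rewrite -[t k]invrK lef_pV2 ?posrE ?invr_gt0 ?powR_gt0 ?mulr_gt0.
rewrite /= -mulrA -invfM -powRM ?(ltW (M0 k)) ?(ltW (W0 k)) //.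
by rewrite ler_pdivlMl // mulrC.
Qed.
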